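(* In the normal-quadratic Downsian election game with parameters $\alpha,\beta>0$ (as specified in the context), there is an anti-pandering equilibrium, which is symmetric and fully revealing: both candidates $i\in\{A,B\}$ play $$y_i(s_i)=\mathbb{E}[\theta\mid s_i,\,s_{-i}=s_i]=\frac{2\beta}{\alpha+2\beta}\,s_i ,$$ and each candidate is elected with probability $1/2$ regardless of the platforms. The voter's welfare in this equilibrium is $$-\frac{\alpha+4\beta}{(\alpha+2\beta)^2}.$$ Moreover, in any symmetric equilibrium in which both candidates use fully revealing and continuous pure strategies, both candidates play $y_i(s_i)=\frac{2\beta}{\alpha+2\beta}s_i$ and the voter's welfare is $-\frac{\alpha+4\beta}{(\alpha+2\beta)^2}$.
   Context: Normal-quadratic Downsian election game. The state is $\theta\sim\mathcal{N}(0,1/\alpha)$; conditional on $\theta$, the two candidates $A,B$ receive independent private signals $s_i\sim\mathcal{N}(\theta,1/\beta)$, $s_i\in\mathbb{R}$. Candidates simultaneously choose platforms $x_A,x_B\in\mathbb{R}$; the voter observes the platforms (not the signals), updates her belief about $\theta$, and elects a candidate $i$, whose platform $x_i$ is implemented. The voter's utility from implemented policy $x$ is $-(x-\theta)^2$. The elected candidate gets utility $1$, the other $0$. A pure strategy of candidate $i$ is a measurable $y_i:\mathbb{R}\to\mathbb{R}$ with $\mathbb{E}[(y_i(s_i)-\theta)^2]<\infty$. A voter strategy is a measurable $w_A:\mathbb{R}^2\to[0,1]$, with $w_A(x_A,x_B)$ the probability that $A$ is elected. An equilibrium is a (weak) perfect Bayesian equilibrium $(y_A,y_B,w_A)$ with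 pure candidate strategies: (i) for each $i$ and a.e. $s_i$, $y_i(s_i)$ maximizes $i$'s conditional winning probability given $s_i$; (ii) the voter's beliefs about $\theta$ follow Bayes' rule on path and are arbitrary off path; (iii) at every platform pair the voter elects $i$ with probability one if $x_i$ gives strictly higher expected utility than $x_{-i}$ under her belief, and may randomize arbitrarily when indifferent. Voter welfare is her ex-ante expected utility. Definitions: a strategy $y_i$ displays anti-pandering if $s_i>0\Rightarrow y_i(s_i)>\mathbb{E}[\theta\mid s_i]$ and $s_i<0\Rightarrow y_i(s_i)<\mathbb{E}[\theta\mid s_i]$, where $\mathbb{E}[\theta\mid s_i]=\frac{\beta}{\alpha+\beta}s_i$; an anti-pandering equilibrium is one in which both candidates' strategies display anti-pandering. A strategy is fully revealing if it is injective. An equilibrium is symmetric if both candidates use the same strategy and both win with positive probability. *)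

(* Defs.v *)
From HB Require Import structures.
From mathcomp Require Import all_boot all_order all_algebra.
From mathcomp Require Import all_classical all_reals all_analysis.

Set Implicit Arguments.
Unset Strict Implicit.
Unset Printing Implicit Defensive.

Import Order.TTheory GRing.Theory Num.Theory.
Import numFieldNormedType.Exports.

Local Open Scope classical_set_scope.
Local Open Scope ring_scope.

(* The second parameter of [normal_prob] and [normal_pdf]
   is a standard deviation, so N(m, 1/a) is [normal_prob m (prec_sd a)]. *)
Definition prec_sd (R : realType) (a : R) : R := Num.sqrt a^-1.

Section Model.
Context (R : realType) (alpha beta : R).
Context d (Omega : measurableType d) (P : probability Omega R).
Variables (theta sA sB : {RV P >-> R}).

(* theta ~ N(0, 1/alpha) and, conditionally on theta, sA and sB are
   independent with law N(theta, 1/beta). *)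
Definition normal_model : Prop :=
  forall T A B : set R, measurable T -> measurable A -> measurable B ->
    P ((theta @^-1` T) `&` (sA @^-1` A) `&` (sB @^-1` B)) =
    (\int[normal_prob 0%R (prec_sd alpha)]_(t in T)
       (normal_prob t (prec_sd beta) A * normal_prob t (prec_sd beta) B))%E.

(* Bayes' rule: the expectation of h theta given that the independent signals
   listed in ss have been observed.  It is defined at every ss, so it fixes a
   version of the conditional expectation, in particular on the Lebesgue-null
   event that both signals coincide. *)
Definition posterior (ss : seq R) (h : R -> R) : R :=
  let lik t := \prod_(s <- ss) normal_pdf t (prec_sd beta) s in
  let prior := normal_prob 0 (prec_sd alpha) in
  (\int[prior]_t (h t * lik t)) / (\int[prior]_t lik t).

Definition posterior_mean (ss : seq R) : R := posterior ss id.

(* Winning probability of a candidate with signal s and platform x when the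
   opponent plays y and w (own platform) (opponent's platform) is the
   probability that the candidate is elected: given theta = t, the opponent's
   signal has law N(t, 1/beta) independently of s. *)
Definition interim_win (w : R -> R -> R) (y : R -> R) (s x : R) : R :=
  posterior [:: s]
    (fun t => \int[normal_prob t (prec_sd beta)]_u w x (y u)).

Definition best_response (si : {RV P >-> R}) (w : R -> R -> R)
    (yi yj : R -> R) : Prop :=
  {ae distribution P si,
    forall s, forall x, interim_win w yj s x <= interim_win w yj s (yi s)}.

Definition strategy (si : {RV P >-> R}) (y : R -> R) : Prop :=
  measurable_fun setT y /\
  ('E_P[fun o => ((y (si o) - theta o) ^+ 2)%R] < +oo)%E.

Definition voter_strategy (wA : R * R -> R) : Prop :=
  measurable_fun setT wA /\ forall p, 0 <= wA p <= 1.

Definition platforms (yA yB : R -> R) (o : Omega) : R * R :=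
  (yA (sA o), yB (sB o)).

(* k is a regular conditional distribution of theta given the platforms. *)
Definition conditional_law (yA yB : R -> R)
    (k : R.-pker (R * R) ~> measurableTypeR R) : Prop :=
  forall (C : set (R * R)) (T : set R), measurable C -> measurable T ->
    P ((platforms yA yB @^-1` C) `&` (theta @^-1` T)) =
    (\int[P]_(o in platforms yA yB @^-1` C) k (platforms yA yB o) T)%E.

Definition belief := R * R -> probability (measurableTypeR R) R.

(* Conditional laws are determined up to null sets only: mu agrees with one of
   them at almost every platform pair for the law of platforms, and is
   unrestricted on the remaining pairs. *)
Definition bayes_on_path (yA yB : R -> R) (mu : belief) : Prop :=
  exists2 k : R.-pker (R * R) ~> measurableTypeR R,
      conditional_law yA yB k &
    {ae pushforward P (platforms yA yB),
      forall p, forall T : set R, measurable T -> mu p T = k p T}.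

(* Extended-real valued, with value -oo under a belief whose second moment is
   infinite. *)
Definition voter_eu (nu : probability (measurableTypeR R) R) (x : R) : \bar R :=
  (\int[nu]_t (- (x - t) ^+ 2)%:E)%E.

Definition voter_optimal (mu : belief) (wA : R * R -> R) : Prop :=
  forall xA xB : R,
    ((voter_eu (mu (xA, xB)) xB < voter_eu (mu (xA, xB)) xA)%E ->
       wA (xA, xB) = 1) /\
    ((voter_eu (mu (xA, xB)) xA < voter_eu (mu (xA, xB)) xB)%E ->
       wA (xA, xB) = 0).

Definition equilibrium (yA yB : R -> R) (wA : R * R -> R) : Prop :=
  [/\ strategy sA yA, strategy sB yB & voter_strategy wA] /\
  [/\ best_response sA (fun x x' => wA (x, x')) yA yB,
      best_response sB (fun x x' => 1 - wA (x', x)) yB yA &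
      exists2 mu : belief, bayes_on_path yA yB mu & voter_optimal mu wA].

Definition winprobA (yA yB : R -> R) (wA : R * R -> R) : \bar R :=
  'E_P[fun o => wA (platforms yA yB o)]%E.

Definition winprobB (yA yB : R -> R) (wA : R * R -> R) : \bar R :=
  'E_P[fun o => (1 - wA (platforms yA yB o))%R]%E.

Definition symmetric_equilibrium (yA yB : R -> R) (wA : R * R -> R) : Prop :=
  equilibrium yA yB wA /\
  [/\ yA = yB, (0 < winprobA yA yB wA)%E & (0 < winprobB yA yB wA)%E].

Definition anti_pandering (y : R -> R) : Prop :=
  forall s : R, (0 < s -> posterior_mean [:: s] < y s) /\
                (s < 0 -> y s < posterior_mean [:: s]).

Definition voter_welfare (yA yB : R -> R) (wA : R * R -> R) : \bar R :=
  'E_P[fun o =>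
    (wA (platforms yA yB o) * - (yA (sA o) - theta o) ^+ 2 +
     (1 - wA (platforms yA yB o)) * - (yB (sB o) - theta o) ^+ 2)%R]%E.

End Model.

(* Main.v *)
(* On path the voter's posterior mean is beta * (s_A + s_B) / (alpha + 2 beta),
   the midpoint of y*(s_A) and y*(s_B) for y* s = 2 beta / (alpha + 2 beta) * s.
   Hence she is indifferent when both candidates play y*, and her expected loss
   is the same whatever w is; taking w = 1 gives its value.

   For uniqueness, let both play y, injective and continuous, so that platforms
   reveal signals.  The game between the candidates is zero-sum, so for almost
   every s' it is optimal for every type to imitate s', and the conditional
   winning probability given s is the same for almost all s'.  The density of
   the opponent's signal given s is, up to factors of one variable, exp (l s u),
   which is a complete kernel; so for almost every opponent signal u the
   probability of winning with y s' against y u does not depend on s'.  But if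
   y s0 differs from y* s0, then for signals s', u near s0 the midpoint of y s'
   and y u is on a fixed side of the posterior mean, so the voter strictly
   prefers y s' or y u according to the sign of s' - u: a contradiction. *)
Require Import Defs.
From mathcomp Require Import all_boot all_order all_algebra.
From mathcomp Require Import all_classical all_reals all_analysis.
From HB Require Import structures.
From mathcomp Require Import measurable_realfun ring lra.
Import Order.TTheory GRing.Theory Num.Theory.
Import numFieldNormedType.Exports.
Local Open Scope classical_set_scope.
Local Open Scope ring_scope.

Set Implicit Arguments.
Unset Strict Implicit.
Unset Printing Implicit Defensive.

(** * Densities and reflections *)

(** The kernel identity is available only for almost every own signal s. So it is tested against D
    itself, where D u is the difference of the winning probabilities of two imitated types against
    the opponent signal u. Positive definiteness turns this into a sum of squared moments of D under
    a Gaussian weight, so every moment vanishes. That D is zero a.e. is not derived: expanding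
    exponentials in these moments makes D orthogonal to normal densities of any centre and
    arbitrarily large precision. By Chebyshev's inequality this is impossible for a bounded function
    that is constantly 1 or constantly -1 near the centre. The double integral converges because the
    correlation of the two signals, beta / (alpha + beta), is below 1.

    Imitation is optimal by a minimax count. Let both candidates imitate types drawn independently
    from the marginal law of a signal. The two payoffs sum to 1, as do the equilibrium payoffs, and
    neither exceeds its equilibrium counterpart. Hence both are equal to it, and almost every
    imitated type attains the equilibrium payoff. *)

Section Density.
Local Open Scope ereal_scope.
Context d (T : measurableType d) (R : realType).
Variables (mu : {measure set T -> \bar R}) (p : T -> R).
Hypothesis mp : measurable_fun setT p.
Hypothesis p0 : forall x, (0 <= p x)%R.

Import HBNNSimple.

(** Normal laws are known only through their values on sets. This is the passage to integrals:
    indicators, simple functions, then monotone limits. *)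
Lemma ge0_integral_density (nu : {measure set T -> \bar R}) (f : T -> \bar R) :
  (forall A, measurable A -> nu A = \int[mu]_(x in A) (p x)%:E) ->
  measurable_fun setT f -> (forall x, 0 <= f x) ->
  \int[nu]_x f x = \int[mu]_x (f x * (p x)%:E).
Proof.
move=> nuE mf f0; pose f_ := nnsfun_approx measurableT mf.
have mpE : measurable_fun setT (EFin \o p) by exact/measurable_EFinP.
have indicE (A : set T) : measurable A ->
    \int[nu]_x (\1_A x)%:E = \int[mu]_x ((\1_A x)%:E * (p x)%:E).
  move=> mA; rewrite integral_indic// setIT nuE// integral_mkcond.
  apply: eq_integral => x _; rewrite patchE indicE.
  by case: (x \in A); rewrite ?mul1e ?mul0e.
have nnsfunE (h : {nnsfun T >-> R}) :
    \int[nu]_x (h x)%:E = \int[mu]_x ((h x)%:E * (p x)%:E).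
  under [LHS]eq_integral do rewrite fimfunE -fsumEFin//.
  rewrite [LHS]ge0_integral_fsum//; last 2 first.
    - by move=> r; exact/measurable_EFinP/measurableT_comp.
    - by move=> n x _; rewrite EFinM nnfun_muleindic_ge0.
  under [RHS]eq_integral.
    move=> x xD; rewrite fimfunE -fsumEFin// ge0_mule_fsuml; last first.
      by move=> r; rewrite EFinM nnfun_muleindic_ge0.
    over.
  rewrite [RHS]ge0_integral_fsum//; last 2 first.
    - move=> r; apply: emeasurable_funM => //.
      by apply/measurable_EFinP; apply/measurableT_comp => //.
    - move=> n x _; rewrite mule_ge0 ?lee_fin// -lee_fin EFinM.
      exact: nnfun_muleindic_ge0.
  apply: eq_fsbigr => r _; rewrite integralZl_indic_nnsfun//.
  (* The finite-support sum runs over all reals, while pulling [r] out needs [r] nonnegative.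
     Outside the range of [h] the level set is empty and both sides are 0. *)
  case: (pselect (r \in range h)) => [rh|rh]; last first.
    rewrite (_ : h @^-1` [set r] = set0); last first.
      apply/seteqP; split => x //= hx; apply: rh; rewrite inE.
      by exists x.
    by rewrite indic0 integral0 mule0; apply/esym/integral0_eq => x _; rewrite mulr0 mul0e.
  have r0 : (0 <= r)%R by move: rh; rewrite inE => -[x _ <-].
  under [RHS]eq_integral do rewrite EFinM -muleA.
  rewrite ge0_integralZl//; last 2 first.
  - by apply: emeasurable_funM => //; exact/measurable_EFinP.
  - by move=> x _; rewrite mule_ge0// lee_fin.
  by rewrite indicE.
transitivity (limn (fun n => \int[nu]_x (f_ n x)%:E)).
  rewrite -monotone_convergence//=.
  - apply: eq_integral => x _; apply/esym/cvg_lim => //=.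
    exact: cvg_nnsfun_approx.
  - by move=> n; apply: measurableT_comp => //; exact: measurable_funTS.
  - by move=> n x _; rewrite lee_fin.
  - by move=> x _ a b ab; rewrite lee_fin//; exact/lefP/nd_nnsfun_approx.
transitivity (limn (fun n => \int[mu]_x ((f_ n x)%:E * (p x)%:E))).
  by congr (limn _); apply/funext => n; rewrite nnsfunE.
rewrite -monotone_convergence//=.
- apply: eq_integral => x _; apply/cvg_lim => //=.
  apply: cvgeZr => //; exact: cvg_nnsfun_approx.
- by move=> n; apply: emeasurable_funM => //; exact/measurable_EFinP.
- by move=> n x _; rewrite mule_ge0 ?lee_fin.
- move=> x _ a b ab; rewrite lee_pmul ?lee_fin//.
  exact/lefP/nd_nnsfun_approx.
Qed.

(** Integrability is not assumed: multiplication by a nonnegative density commutes with taking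
    positive and negative parts. *)
Lemma integral_density (nu : {measure set T -> \bar R}) (f : T -> \bar R) :
  (forall A, measurable A -> nu A = \int[mu]_(x in A) (p x)%:E) ->
  measurable_fun setT f ->
  \int[nu]_x f x = \int[mu]_x (f x * (p x)%:E).
Proof.
move=> nuE mf; rewrite integralE [RHS]integralE.
rewrite !(ge0_integral_density nuE)//;
  [|exact: measurable_funeneg|exact: measurable_funepos].
congr (_ - _); apply: eq_integral => x _.
  by rewrite !funeposE maxe_pMl ?lee_fin// mul0e.
by rewrite !funenegE maxe_pMl ?lee_fin// mul0e mulNe.
Qed.

(** The two proofs are arguments so that the measure structure, which depends on them, can be
    attached to this function. *)
Definition density_measure of measurable_fun setT p & (forall x, (0 <= p x)%R) :=
  fun A : set T => \int[mu]_(x in A) (p x)%:E.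

Local Notation dens := (density_measure mp p0).

Let dens0 : dens set0 = 0. Proof. by rewrite /density_measure integral_set0. Qed.

Let dens_ge0 A : 0 <= dens A.
Proof. by apply: integral_ge0 => x _; rewrite lee_fin. Qed.

Let dens_sigma_additive : semi_sigma_additive dens.
Proof.
move=> /= F mF tF mUF; rewrite /density_measure; apply: cvg_toP.
  apply: ereal_nondecreasing_is_cvgn => m n mn.
  apply: lee_sum_nneg_natr => // k _ _; apply: integral_ge0 => /= x Fkx.
  by rewrite lee_fin.
rewrite ge0_integral_bigcup//=.
- by apply/measurable_funTS/measurable_EFinP.
- by move=> x _; rewrite lee_fin.
Qed.

HB.instance Definition _ := isMeasure.Build _ _ _
  dens dens0 dens_ge0 dens_sigma_additive.

End Density.

Section Reflection.
Local Open Scope ereal_scope.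
Context (R : realType).
Local Notation mu := (@lebesgue_measure R).

(** A reflection sends a half-open interval to one of the same length, closed at the other end, and
    lengths of intervals determine Lebesgue measure. *)
Lemma lebesgue_measure_reflect (c : R) (A : set R) : measurable A ->
  pushforward mu ((fun x => c - x)%R : _ -> measurableTypeR R) A = mu A.
Proof.
have mr : measurable_fun setT ((fun x => c - x)%R : R -> measurableTypeR R).
  by apply: measurable_funB.
move=> mA; apply/esym/lebesgue_measure_unique => //= _ [[a b]] _ <-.
rewrite /pushforward /=.
have -> : ((fun x : R => (c - x)%R) @^-1` `]a, b]) = `[(c - b)%R, (c - a)%R[%classic :> set R.
  by apply/seteqP; split => x /=; rewrite !in_itv/= => /andP[? ?]; apply/andP; split; lra.
rewrite !lebesgue_measure_itv/= !lte_fin ltrD2l ltrN2 -!EFinD.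
by case: ifP => // _; congr EFin; lra.
Qed.

Lemma ge0_integral_reflect (c : R) (f : R -> \bar R) :
  measurable_fun setT f -> (forall x, 0 <= f x) ->
  \int[mu]_x f (c - x)%R = \int[mu]_x f x.
Proof.
move=> mf f0.
have mr : measurable_fun setT ((fun x => c - x)%R : R -> measurableTypeR R).
  by apply: measurable_funB.
transitivity (\int[pushforward mu ((fun x => c - x)%R : _ -> measurableTypeR R)]_x f x).
  by rewrite ge0_integral_pushforward.
by apply: eq_measure_integral => A mA _; exact: lebesgue_measure_reflect.
Qed.

(** A translation is a composition of two reflections. *)
Lemma ge0_integral_shift (c : R) (f : R -> \bar R) :
  measurable_fun setT f -> (forall x, 0 <= f x) ->
  \int[mu]_x f (x - c)%R = \int[mu]_x f x.
Proof.
move=> mf f0; rewrite -[RHS](ge0_integral_reflect 0)//.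
rewrite -[RHS](ge0_integral_reflect c)//.
- by apply: eq_integral => x _; congr f; lra.
- by apply: measurableT_comp => //; apply: measurable_funB.
Qed.

End Reflection.

(** * Moments of the normal law *)

Section NormalMoments.
Context (R : realType).
Local Notation mu := (@lebesgue_measure R).
Implicit Types m s : R.

Lemma normal_pdf_expR m s (x : R) : s != 0 ->
  normal_pdf m s x = normal_peak s * expR (- (x - m) ^+ 2 / (s ^+ 2 *+ 2)).
Proof. by move=> s0; rewrite normal_pdfE. Qed.

Lemma normal_pdf_center m s (x : R) : s != 0 -> normal_pdf m s x = normal_pdf 0 s (x - m).
Proof. by move=> s0; rewrite !normal_pdf_expR// subr0. Qed.

Lemma measurable_normal_pdf_comp d (T : measurableType d) s (f g : T -> R) :
  s != 0 -> measurable_fun setT f -> measurable_fun setT g ->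
  measurable_fun setT (fun x => normal_pdf (f x) s (g x)).
Proof.
move=> s0 mf mg; under eq_fun do rewrite normal_pdf_center//.
apply: measurableT_comp; first exact: measurable_normal_pdf.
exact: measurable_funB.
Qed.

Lemma is_derive_normal_pdf0 s (x : R) : s != 0 ->
  is_derive x (1 : R^o) (normal_pdf 0 s : R^o -> R^o) (- (x / s ^+ 2 * normal_pdf 0 s x)).
Proof.
move=> s0; rewrite normal_pdfE//.
pose a := (s ^+ 2 *+ 2)^-1.
have -> : (fun x0 : R => normal_peak s * normal_fun 0 s x0) =
    (fun x0 : R => normal_peak s * (expR \o (fun z => - a * z ^+ 2)) x0).
  by apply/funext => z; rewrite /normal_fun /= subr0 !mulNr [a * _]mulrC.
have h1 : is_derive x (1 : R) (fun z : R => z) 1 by exact: is_derive_id.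
have da : is_derive x (1 : R) (fun z : R => - a * z ^+ 2) (- a * (x *+ 2)).
  apply: (is_derive_eq (is_deriveZ (- a) (is_deriveX 2 h1))).
  by rewrite /GRing.scale/= expr1 mulr1 mulr_natl.
have de : is_derive x (1 : R) (expR \o (fun z : R => - a * z ^+ 2))
    (expR (- a * x ^+ 2) * (- a * (x *+ 2))).
  exact: is_derive1_comp.
apply: (is_derive_eq (is_deriveZ (normal_peak s) de)).
rewrite /GRing.scale /= /a.
have -> : normal_fun 0 s x = expR (- (s ^+ 2 *+ 2)^-1 * x ^+ 2).
  by rewrite /normal_fun subr0 mulrC mulrN mulNr.
have : s ^+ 2 != 0 by rewrite expf_neq0.
have key (q e v : R) : v != 0 ->
    q * (e * (- (v *+ 2)^-1 * (x *+ 2))) = - (x / v * (q * e)).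
  by move=> v0; rewrite !mulr2n; field; rewrite v0 /= -mulr2n mulrn_eq0.
exact: key.
Qed.

Lemma normal_pdf0_cvgy s : s != 0 -> normal_pdf 0 s x @[x --> +oo] --> (0:R).
Proof.
move=> s0; rewrite normal_pdfE//.
rewrite -[X in _ --> X](mulr0 (normal_peak s)).
apply: cvgM; first exact: cvg_cst.
have -> : normal_fun 0 s = (fun x => expR (- x)) \o (fun z => z ^+ 2 * (s ^+ 2 *+ 2)^-1).
  by apply/funext => z; rewrite /normal_fun /= subr0 mulNr.
apply: cvg_comp; last exact: cvgr_expR.
apply: gt0_cvgMly; last exact: cvgr_expr2.
by rewrite invr_gt0 pmulrn_lgt0// exprn_even_gt0.
Qed.

(** The centred density phi satisfies phi' = - (v / s ^+ 2) phi, so - phi is an antiderivative of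
    the integrand. For 0 <= x the integrand is nonnegative. *)
Lemma normal_pdf0_tail s (x : R) : s != 0 -> 0 <= x ->
  (\int[mu]_(v in `[x, +oo[) (v / s ^+ 2 * normal_pdf 0 s v)%:E)%E = (normal_pdf 0 s x)%:E.
Proof.
move=> s0 x0.
have s20 : 0 < s ^+ 2 by rewrite exprn_even_gt0.
rewrite (@ge0_continuous_FTC2y R _ (fun v => - normal_pdf 0 s v) x 0).
- by rewrite EFinN oppeK add0e.
- move=> v xv; rewrite mulr_ge0 ?normal_pdf_ge0// divr_ge0 ?(ltW s20)//.
  exact: le_trans xv.
- apply: continuous_subspaceT => v; apply: cvgM; last exact: continuous_normal_pdf.
  by apply: cvgM; [exact: cvg_id|exact: cvg_cst].
- by rewrite -[X in _ --> X]oppr0; apply: cvgN; exact: normal_pdf0_cvgy.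
- move=> v xv; have := is_derive_normal_pdf0 v s0 => h.
  by apply: derivableN; case: h.
- by apply: cvgN; apply: cvg_at_right_filter; exact: continuous_normal_pdf.
- move=> v _; have h := is_derive_normal_pdf0 v s0.
  rewrite derive1E deriveN; last by case: h.
  by rewrite derive_val opprK.
Qed.

Let tri : set (R * R) := [set p | 0 <= p.1 <= p.2].

Let measurable_tri : measurable tri.
Proof.
have -> : tri = (fun p : R * R => (0 <= p.1) && (p.1 <= p.2)) @^-1` [set true].
  by apply/seteqP; split => p.
rewrite -[X in measurable X]setTI; apply: measurable_and => //.
  by apply: measurable_fun_ler => //.
by apply: measurable_fun_ler.
Qed.

(** Tonelli on the triangle 0 <= x <= v replaces integration by parts. Integrating v / s ^+ 2 times
    the density over v first gives the density at x by the tail formula; integrating over x first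
    multiplies by v. *)
Let halfnormal s : s != 0 ->
  (\int[mu]_(x in `[0%R, +oo[) (x ^+ 2 / s ^+ 2 * normal_pdf 0 s x)%:E =
   \int[mu]_(x in `[0%R, +oo[) (normal_pdf 0 s x)%:E)%E.
Proof.
move=> s0.
have s20 : 0 < s ^+ 2 by rewrite exprn_even_gt0.
pose h (p : R * R) : \bar R := (\1_tri p * (p.2 / s ^+ 2 * normal_pdf 0 s p.2))%:E.
have mh : measurable_fun setT h.
  apply/measurable_EFinP; apply: measurable_funM.
    exact: measurable_indic.
  apply: measurable_funM; first by apply: measurable_funM.
  exact: measurable_normal_pdf_comp.
have h0 p : (0 <= h p)%E.
  rewrite lee_fin indicE; case: (boolP (p \in tri)); rewrite ?mul0r// inE /tri/= => /andP[p0 p1].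
  rewrite mul1r mulr_ge0 ?normal_pdf_ge0// divr_ge0 ?(ltW s20)//.
  exact: le_trans p1.
have := @fubini_tonelli _ _ _ _ R mu mu h mh h0.
have -> : (\int[mu]_x \int[mu]_y h (x, y) =
   \int[mu]_(x in `[0%R, +oo[) (normal_pdf 0 s x)%:E)%E.
  rewrite [RHS]integral_mkcond; apply: eq_integral => x _.
  rewrite patchE mem_setE in_itv/= andbT; case: ifPn => x0.
    rewrite -normal_pdf0_tail// [RHS]integral_mkcond; apply: eq_integral => v _.
    rewrite patchE mem_setE in_itv/= andbT /h indicE.
    rewrite (_ : ((x, v) \in tri) = (x <= v)); last first.
      by apply/idP/idP; rewrite inE /tri/= x0.
    by case: ifPn => _; rewrite ?mul1r ?mul0r.
  apply: integral0_eq => v _; rewrite /h indicE memNset ?mul0r// /tri/=.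
  by rewrite (negbTE x0).
move=> ->; rewrite integral_mkcond; apply: eq_integral => v _.
rewrite patchE mem_setE in_itv/= andbT; case: ifPn => v0; last first.
  apply/esym; apply: integral0_eq => x _; rewrite /h indicE memNset ?mul0r// /tri/=.
  move=> /andP[x0 xv]; move: v0; rewrite -ltNge => v0.
  by have := lt_le_trans v0 (le_trans x0 xv); rewrite ltxx.
transitivity (\int[mu]_x ((v / s ^+ 2 * normal_pdf 0 s v)%:E * (\1_(`[0, v]) x)%:E))%E.
  rewrite ge0_integralZl//.
  - rewrite integral_indic//= setIT lebesgue_measure_itv/= lte_fin.
    move: v0; rewrite le_eqVlt => /predU1P[<-|v0].
      by rewrite ltxx mule0 expr0n/= !mul0r.
    by rewrite v0 -EFinD -EFinM; congr EFin; rewrite subr0; ring.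
  - by apply/measurable_EFinP; apply: measurable_indic.
  - by rewrite lee_fin mulr_ge0 ?normal_pdf_ge0// divr_ge0 ?(ltW s20).
apply: eq_integral => x _; rewrite /h -EFinM mulrC; congr (EFin (_ * _)).

Qed.

Lemma integral_normal_pdf_sqr s : s != 0 ->
  (\int[mu]_x (x ^+ 2 * normal_pdf 0 s x)%:E)%E = (s ^+ 2)%:E.
Proof.
move=> s0.
have s20 : s ^+ 2 != 0 by rewrite expf_neq0.
have -> : (\int[mu]_x (x ^+ 2 * normal_pdf 0 s x)%:E =
   (s ^+ 2)%:E * \int[mu]_x (x ^+ 2 / s ^+ 2 * normal_pdf 0 s x)%:E)%E.
  rewrite -ge0_integralZl//.
  - apply: eq_integral => x _; rewrite -EFinM; congr EFin.
    by rewrite mulrA mulrCA mulfV// mulr1.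
  - apply/measurable_EFinP; apply: measurable_funM; last exact: measurable_normal_pdf.
    by apply: measurable_funM => //; apply: measurable_funX.
  - by move=> x _; rewrite lee_fin mulr_ge0 ?normal_pdf_ge0// divr_ge0// sqr_ge0.
  - by rewrite lee_fin sqr_ge0.
suff -> : (\int[mu]_x (x ^+ 2 / s ^+ 2 * normal_pdf 0 s x)%:E = 1)%E by rewrite mule1.
have e : [set x : R | 0 <= x] = `[0, +oo[%classic.
  by apply/seteqP; split => x/=; rewrite in_itv/= andbT.
rewrite ge0_symfun_integralT/=; first last.
- by move=> x /=; rewrite sqrrN !normal_pdf_expR// !subr0 sqrrN.
- move=> v; apply: cvgM; last exact: continuous_normal_pdf.
  apply: cvgM; last exact: cvg_cst.
  exact: exprn_continuous.
- by move=> x; rewrite mulr_ge0 ?normal_pdf_ge0// divr_ge0// sqr_ge0.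
rewrite e halfnormal// -e -(@ge0_symfun_integralT R (normal_pdf 0 s)).
- exact: integral_normal_pdf.
- by move=> x; exact: normal_pdf_ge0.
- exact: continuous_normal_pdf.
- by move=> x /=; rewrite !normal_pdf_expR// !subr0 sqrrN.
Qed.

End NormalMoments.

(** * Integrals under normal laws and conjugacy *)

Section NormalProb.
Context (R : realType).
Local Notation mu := (@lebesgue_measure R).
Implicit Types m s : R.

Lemma ge0_integral_normal_prob m s (f : R -> \bar R) :
  measurable_fun setT f -> (forall x, 0 <= f x)%E ->
  (\int[normal_prob m s]_x f x = \int[mu]_x (f x * (normal_pdf m s x)%:E))%E.
Proof.
move=> mf f0; apply: ge0_integral_density => //.
- exact: measurable_normal_pdf.
- by move=> x; exact: normal_pdf_ge0.
Qed.

Lemma integral_normal_prob m s (f : R -> \bar R) : measurable_fun setT f ->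
  (\int[normal_prob m s]_x f x = \int[mu]_x (f x * (normal_pdf m s x)%:E))%E.
Proof.
move=> mf; apply: integral_density => //.
- exact: measurable_normal_pdf.
- by move=> x; exact: normal_pdf_ge0.
Qed.

Lemma integral_normal_prob_sqr m s : s != 0 ->
  (\int[normal_prob m s]_x ((x - m) ^+ 2)%:E = (s ^+ 2)%:E)%E.
Proof.
move=> s0; rewrite ge0_integral_normal_prob//.
- apply: etrans (integral_normal_pdf_sqr s0).
  rewrite -[RHS](ge0_integral_shift m).
  + by apply: eq_integral => x _; rewrite (normal_pdf_center m)//.
  + apply/measurable_EFinP/measurable_funM; last exact: measurable_normal_pdf.
    by apply: measurable_funX.
  + by move=> x; rewrite lee_fin mulr_ge0 ?sqr_ge0// normal_pdf_ge0.
- by apply/measurable_EFinP/measurable_funX/measurable_funB.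
- by move=> x; rewrite lee_fin sqr_ge0.
Qed.

Lemma integrable_normal_prob_sqr m s : s != 0 ->
  (normal_prob m s).-integrable setT (fun x => ((x - m) ^+ 2)%:E).
Proof.
move=> s0; apply/integrableP; split.
  by apply/measurable_EFinP/measurable_funX/measurable_funB.
under eq_integral do rewrite /= ger0_norm ?sqr_ge0//.
by rewrite integral_normal_prob_sqr// ltry.
Qed.

Lemma integrable_normal_prob_center m s : s != 0 ->
  (normal_prob m s).-integrable setT (fun x => (x - m)%:E).
Proof.
move=> s0.
have ig : (normal_prob m s).-integrable setT (fun x => 1 + ((x - m) ^+ 2)%:E)%E.
  apply: integrableD => //; last exact: integrable_normal_prob_sqr.
  exact: finite_measure_integrable_cst.
apply: (le_integrable measurableT _ _ ig).
- by apply/measurable_EFinP/measurable_funB.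
- move=> x _ /=; rewrite lee_fin [leRHS]ger0_norm; last by rewrite addr_ge0// sqr_ge0.
  have := sqr_ge0 (`|x - m| - 1); have := normr_ge0 (x - m).
  by rewrite -[in X in _ -> _ -> X](real_normK (num_real (x - m))); nra.
Qed.

Lemma integral_normal_prob_cst m s (c : R) :
  (\int[normal_prob m s]_x c%:E = c%:E)%E.
Proof. by rewrite integral_cst//= [X in (_ * X)%E]probability_setT mule1. Qed.

Lemma normal_pdf_reflect m s (x : R) : s != 0 ->
  normal_pdf m s (m *+ 2 - x) = normal_pdf m s x.
Proof.
move=> s0; rewrite !normal_pdf_expR//.
suff -> : (m *+ 2 - x - m) ^+ 2 = (x - m) ^+ 2 by [].
by rewrite mulr2n; ring.
Qed.

(** The reflection about m exchanges the positive and negative parts; integrability makes their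
    difference 0 rather than indeterminate. *)
Lemma integral_normal_prob_center m s : s != 0 ->
  (\int[normal_prob m s]_x (x - m)%:E = 0)%E.
Proof.
move=> s0.
have mf : measurable_fun setT (fun x : R => (x - m)%:E).
  by apply/measurable_EFinP/measurable_funB.
have := integrable_normal_prob_center m s0 => fi.
rewrite integralE.
suff -> : (\int[normal_prob m s]_x (fun x : R => (x - m)%:E)^\+ x =
           \int[normal_prob m s]_x (fun x : R => (x - m)%:E)^\- x)%E.
  rewrite subee//; apply: integrable_neg_fin_num => //.
rewrite !ge0_integral_normal_prob//; last 2 first.
- exact: measurable_funeneg.
- exact: measurable_funepos.
rewrite -[RHS](ge0_integral_reflect (m *+ 2)).
- apply: eq_integral => x _; rewrite funeposE funenegE normal_pdf_reflect//.
  have -> : (x - m)%:E = (- (m *+ 2 - x - m)%:E)%E :> \bar R.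
    by rewrite -EFinN mulr2n; congr EFin; ring.
  by [].
- apply: emeasurable_funM; first exact: measurable_funeneg.
  by apply/measurable_EFinP; exact: measurable_normal_pdf.
- by move=> x; rewrite mule_ge0// lee_fin normal_pdf_ge0.
Qed.

Lemma integrable_normal_prob_id m s : s != 0 ->
  (normal_prob m s).-integrable setT (fun x => x%:E).
Proof.
move=> s0; rewrite (_ : EFin = (fun x => (x - m)%:E) \+ cst m%:E)%E; last first.
  by apply/funext => x /=; rewrite -EFinD subrK.
apply: integrableD => //; first exact: integrable_normal_prob_center.
exact: finite_measure_integrable_cst.
Qed.

Lemma integral_normal_prob_id m s : s != 0 ->
  (\int[normal_prob m s]_x x%:E = m%:E)%E.
Proof.
move=> s0; transitivity (\int[normal_prob m s]_x ((x - m)%:E + m%:E))%E.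
  by apply: eq_integral => x _; rewrite -EFinD subrK.
rewrite integralD//; last 2 first.
- exact: integrable_normal_prob_center.
- exact: finite_measure_integrable_cst.
by rewrite integral_normal_prob_center// add0e integral_normal_prob_cst.
Qed.

Lemma integral_normal_prob_sqrB m s (x : R) : s != 0 ->
  (\int[normal_prob m s]_t ((x - t) ^+ 2)%:E = ((x - m) ^+ 2 + s ^+ 2)%:E)%E.
Proof.
move=> s0.
transitivity (\int[normal_prob m s]_t (((t - m) ^+ 2)%:E +
   ((2 * (m - x))%:E * (t - m)%:E + ((x - m) ^+ 2)%:E)))%E.
  by apply: eq_integral => t _; rewrite -EFinM -!EFinD; congr EFin; ring.
have i1 := integrable_normal_prob_sqr m s0.
have i2 : (normal_prob m s).-integrable setT (fun t => (2 * (m - x))%:E * (t - m)%:E)%E.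
  by apply: integrableZl => //; exact: integrable_normal_prob_center.
have i3 : (normal_prob m s).-integrable setT (fun t : R => ((x - m) ^+ 2)%:E).
  exact: finite_measure_integrable_cst.
rewrite integralD//; last by apply: integrableD.
rewrite integralD// integral_normal_prob_sqr// integralZl//; last first.
  exact: integrable_normal_prob_center.
rewrite integral_normal_prob_center// mule0 add0e integral_normal_prob_cst.
by rewrite -EFinD addrC.
Qed.

Lemma prec_sd_neq0 (a : R) : 0 < a -> prec_sd a != 0.
Proof. by move=> a0; rewrite gt_eqF// sqrtr_gt0 invr_gt0. Qed.

Lemma sqr_prec_sd (a : R) : 0 < a -> prec_sd a ^+ 2 = a^-1.
Proof. by move=> a0; rewrite sqr_sqrtr// invr_ge0 ltW. Qed.

Lemma normal_pdf_prec (a m x : R) : 0 < a ->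
  normal_pdf m (prec_sd a) x = normal_peak (prec_sd a) * expR (- (a / 2) * (x - m) ^+ 2).
Proof.
move=> a0; rewrite normal_pdf_expR ?prec_sd_neq0// sqr_prec_sd//.
congr (_ * expR _); rewrite mulr2n; field.
by rewrite !(gt_eqF a0, gt_eqF (addr_gt0 ltr01 ltr01))//=.
Qed.

(** Normal conjugacy by completing the square in t. The rate a * b / (a + b) is the precision of a
    sum of independent errors of precisions a and b. *)
Lemma normal_pdf_mul (a b m s t : R) : 0 < a -> 0 < b ->
  normal_pdf m (prec_sd a) t * normal_pdf t (prec_sd b) s =
  (normal_peak (prec_sd a) * normal_peak (prec_sd b) / normal_peak (prec_sd (a + b)) *
   expR (- (a * b / (a + b) / 2) * (s - m) ^+ 2)) *
  normal_pdf ((a * m + b * s) / (a + b)) (prec_sd (a + b)) t.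
Proof.
move=> a0 b0; have ab0 := addr_gt0 a0 b0.
rewrite !normal_pdf_prec//.
have := normal_peak_gt0 (prec_sd_neq0 ab0).
move: (normal_peak _) (normal_peak _) (normal_peak _) => p1 p2 p3 p30.
rewrite mulrACA -expRD [RHS]mulrACA -expRD divfK ?gt_eqF//; congr (_ * expR _).
by field; rewrite gt_eqF.
Qed.

End NormalProb.

(** * The joint law of state and signals *)

Section MeasureRectangles.
Local Open Scope ereal_scope.
Context (R : realType).

Lemma measure_unique_rectangle d1 d2 (T1 : measurableType d1)
    (T2 : measurableType d2) (m1 m2 : {measure set (T1 * T2) -> \bar R}) :
  m1 setT < +oo ->
  (forall A B, measurable A -> measurable B -> m1 (A `*` B) = m2 (A `*` B)) ->
  forall C, measurable C -> m1 C = m2 C.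
Proof.
move=> m1T m12 C mC.
apply: (measure_unique [set A `*` B | A in measurable & B in measurable]
  (fun=> setT)) => //.
- exact: measurable_prod_measurableType.
- move=> _ _ [A mA [B mB <-]] [A' mA' [B' mB' <-]].
  exists (A `&` A'); first exact: measurableI.
  by exists (B `&` B'); [exact: measurableI|rewrite setXI].
- by move=> _; exists setT => //; exists setT => //; rewrite setXTT.
- by apply/seteqP; split => // x _; exists 0%N.
- by move=> _ [A mA [B mB <-]]; exact: m12.
Qed.

(** For fixed C, the map D to m (D [*] C) is the image under [fst] of a restriction of m. It is a
    finite measure, so the two-factor case applies to it. *)
Lemma measure_unique_rectangle3 d1 d2 d3 (T1 : measurableType d1)
    (T2 : measurableType d2) (T3 : measurableType d3)
    (m1 m2 : {measure set (T1 * T2 * T3) -> \bar R}) :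
  m1 setT < +oo ->
  (forall A B C, measurable A -> measurable B -> measurable C ->
     m1 (A `*` B `*` C) = m2 (A `*` B `*` C)) ->
  forall D, measurable D -> m1 D = m2 D.
Proof.
move=> m1T m12 D mD; apply: (measure_unique_rectangle m1T) => // {D mD}D C mD mC.
have mTC : measurable (setT `*` C : set (T1 * T2 * T3)) by exact: measurableX.
have mfst : measurable_fun setT (fst : T1 * T2 * T3 -> T1 * T2) by [].
have E (m : {measure set (T1 * T2 * T3) -> \bar R}) (D' : set (T1 * T2)) :
    pushforward (mrestr m mTC) fst D' = m (D' `*` C).
  rewrite /pushforward /mrestr; congr (m _).
  by apply/seteqP; split => -[x y] /= [] //= ? []; split.
rewrite -!E; apply: (measure_unique_rectangle (m1 := pushforward (mrestr m1 mTC) fst)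
   (m2 := pushforward (mrestr m2 mTC) fst)) => //.
- rewrite [X in (X < _)%E]E; apply: le_lt_trans m1T; apply: le_measure => //; rewrite inE//; exact: mTC.
- move=> A B mA mB; apply: (etrans (E m1 _)); apply: (etrans _ (esym (E m2 _))).
  exact: m12.
Qed.

End MeasureRectangles.

(** The probability of V is a partial integral of a jointly measurable density, so Tonelli gives its
    measurability in the mean. *)
Lemma measurable_normal_prob (R : realType) d (T : measurableType d) (m : T -> R) (s : R)
    (V : set R) : s != 0 -> measurable_fun setT m -> measurable V ->
  measurable_fun setT (fun x => normal_prob (m x) s V).
Proof.
move=> s0 mm mV.
pose f (p : T * measurableTypeR R) : \bar R := (\1_V p.2 * normal_pdf (m p.1) s p.2)%:E.
have mf : measurable_fun setT f.
  apply/measurable_EFinP/measurable_funM.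
    by apply: (measurableT_comp (measurable_indic mV)); exact: measurable_snd.
  apply: measurable_normal_pdf_comp => //; exact: measurableT_comp.
have f0 p : (0 <= f p)%E.
  by rewrite lee_fin mulr_ge0 ?normal_pdf_ge0// indicE.
have := measurable_fun_fubini_tonelli_F (m2 := lebesgue_measure) f mf f0.
rewrite (_ : fubini_F _ _ = fun x => normal_prob (m x) s V)//.
apply/funext => x; rewrite /fubini_F /normal_prob [RHS]integral_mkcond.
apply: eq_integral => y _.
by rewrite patchE /f /= indicE; case: (y \in V); rewrite ?mul1r ?mul0r.
Qed.

(* Copied onto an alias because the library's instances on products of
   subprobabilities prevent [lebesgue_measure \x lebesgue_measure] from being
   recognised as sigma-finite. *)
Definition lebesgue_measure2 (R : realType) :=
  (@lebesgue_measure R \x @lebesgue_measure R)%E.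

Section Lebesgue2.
Context (R : realType).
Local Notation mu := (@lebesgue_measure R).

HB.instance Definition _ := Measure.on (@lebesgue_measure2 R).

Let lebesgue2_sigma_finite : sigma_finite setT (@lebesgue_measure2 R).
Proof.
have /sigma_finiteP[F [TF ndF Foo]] := sigma_finiteT mu.
exists (fun n => F n `*` F n).
  rewrite -setXTT TF predeqE => -[x y]; split.
    move=> [/= [n _ Fnx] [k _ Gky]]; exists (maxn n k) => //; split.
    - by move: x Fnx; exact/subsetPset/ndF/leq_maxl.
    - by move: y Gky; exact/subsetPset/ndF/leq_maxr.
  by move=> [n _ []/= ? ?]; split; exists n.
move=> k; have [? ?] := Foo k.
split; first exact: measurableX.
by rewrite /lebesgue_measure2 product_measure1E// lte_mul_pinfty// ge0_fin_numE.
Qed.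

HB.instance Definition _ := Measure_isSigmaFinite.Build _ _ _
  (@lebesgue_measure2 R) lebesgue2_sigma_finite.

End Lebesgue2.

Section JointLaw.
Context (R : realType) (alpha beta : R) (alpha_gt0 : 0 < alpha) (beta_gt0 : 0 < beta).
Local Notation mu := (@lebesgue_measure R).
Local Notation tau := (alpha + 2 * beta).

Definition post_mean2 (s u : R) : R := beta * (s + u) / (alpha + 2 * beta).

(* Integrating [joint_pdf] over the state by completing the square. *)
Definition signal_pdf (s u : R) : R :=
  normal_peak (prec_sd alpha) * normal_peak (prec_sd beta) ^+ 2 /
    normal_peak (prec_sd (alpha + 2 * beta)) *
  expR (- (beta * (alpha + beta) / (alpha + 2 * beta) / 2) * (s ^+ 2 + u ^+ 2) +
        beta ^+ 2 / (alpha + 2 * beta) * (s * u)).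

Definition joint_pdf (t s u : R) : R :=
  normal_pdf 0 (prec_sd alpha) t * normal_pdf t (prec_sd beta) s *
  normal_pdf t (prec_sd beta) u.

Lemma tau_gt0 : 0 < tau.
Proof. by rewrite addr_gt0// mulr_gt0. Qed.

Lemma signal_pdf_gt0 s u : 0 < signal_pdf s u.
Proof.
rewrite mulr_gt0 ?expR_gt0// divr_gt0 ?normal_peak_gt0 ?prec_sd_neq0 ?tau_gt0//.
by rewrite mulr_gt0 ?exprn_gt0// normal_peak_gt0// prec_sd_neq0.
Qed.

Lemma signal_pdfC s u : signal_pdf s u = signal_pdf u s.
Proof. by rewrite /signal_pdf [s ^+ 2 + _]addrC [s * u]mulrC. Qed.

Lemma joint_pdfE t s u : joint_pdf t s u =
  signal_pdf s u * normal_pdf (post_mean2 s u) (prec_sd tau) t.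
Proof.
have t0 := tau_gt0.
rewrite /joint_pdf /signal_pdf !normal_pdf_prec//.
have := normal_peak_gt0 (prec_sd_neq0 t0).
move: (normal_peak _) (normal_peak _) (normal_peak _) => p1 p2 p3 p30.
rewrite /post_mean2 -[_ * expR _ * _ in LHS]mulrACA -expRD [LHS]mulrACA -expRD.
rewrite [RHS]mulrACA -expRD divfK ?gt_eqF// expr2 mulrA; congr (_ * expR _); first ring.
by field; rewrite gt_eqF.
Qed.

Lemma joint_pdf_ge0 t s u : 0 <= joint_pdf t s u.
Proof. by rewrite !mulr_ge0 ?normal_pdf_ge0. Qed.

Lemma measurable_joint_pdf d (T : measurableType d) (f g h : T -> R) :
  measurable_fun setT f -> measurable_fun setT g -> measurable_fun setT h ->
  measurable_fun setT (fun x => joint_pdf (f x) (g x) (h x)).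
Proof.
move=> mf mg mh; apply: measurable_funM; first apply: measurable_funM.
- by apply: measurable_normal_pdf_comp => //; exact: prec_sd_neq0.
- by apply: measurable_normal_pdf_comp => //; exact: prec_sd_neq0.
- by apply: measurable_normal_pdf_comp => //; exact: prec_sd_neq0.
Qed.

Lemma measurable_signal_pdf d (T : measurableType d) (g h : T -> R) :
  measurable_fun setT g -> measurable_fun setT h ->
  measurable_fun setT (fun x => signal_pdf (g x) (h x)).
Proof.
move=> mg mh; apply: measurable_funM => //; apply: measurableT_comp => //.
apply: measurable_funD; apply: measurable_funM => //.
- by apply: measurable_funD; apply: measurable_funX.
- exact: measurable_funM.
Qed.

Lemma integral_joint_pdf s u :
  (\int[mu]_t (joint_pdf t s u)%:E = (signal_pdf s u)%:E)%E.
Proof.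
under eq_integral do rewrite joint_pdfE EFinM.
rewrite ge0_integralZl//.
- by rewrite integral_normal_pdf mule1.
- by apply/measurable_EFinP; exact: measurable_normal_pdf.
- by move=> t _; rewrite lee_fin normal_pdf_ge0.
- by rewrite lee_fin ltW// signal_pdf_gt0.
Qed.

Context d (Omega : measurableType d) (P : probability Omega R).
Variables (theta sA sB : {RV P >-> R}).
Hypothesis model : normal_model alpha beta theta sA sB.

Let m3 (p : R * R * R) := joint_pdf p.2 p.1.1 p.1.2.
Let mm3 : measurable_fun setT m3.
Proof. by apply: measurable_joint_pdf => //; apply: measurableT_comp. Qed.
Let m30 p : 0 <= m3 p. Proof. exact: joint_pdf_ge0. Qed.

Local Notation RT := (measurableTypeR R).
Let X o : RT * RT * RT := ((sA o, sB o), theta o).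
Let mX : measurable_fun setT X.
Proof.
have m1 : measurable_fun setT (sA : Omega -> RT) := measurable_funPT sA.
have m2 : measurable_fun setT (sB : Omega -> RT) := measurable_funPT sB.
have m3' : measurable_fun setT (theta : Omega -> RT) := measurable_funPT theta.
exact: (measurable_fun_pair (measurable_fun_pair m1 m2) m3').
Qed.

Local Notation mu2 := (@lebesgue_measure2 R).

(** The model prescribes the law on boxes only; there Tonelli gives the density formula, and finite
    measures that agree on boxes are equal. *)
Lemma law_density (D : set (RT * RT * RT)) : measurable D ->
  pushforward P X D = (\int[mu2 \x mu]_(p in D) (m3 p)%:E)%E.
Proof.
pose nu : {measure set (RT * RT * RT) -> \bar R} :=
  density_measure (mu2 \x mu)%E mm3 m30.
move=> mD; apply: (measure_unique_rectangle3 (m2 := nu)) => //.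
  by rewrite /= /pushforward preimage_setT probability_setT ltry.
move=> A B T mA mB mT.
transitivity (P ((theta @^-1` T) `&` (sA @^-1` A) `&` (sB @^-1` B))).
  rewrite /pushforward; congr (P _).
  by apply/seteqP; split => o /= [[]].
rewrite model// /nu /= /density_measure.
pose f (p : RT * RT * RT) : \bar R :=
  ((\1_A p.1.1 * \1_B p.1.2 * \1_T p.2) * m3 p)%:E.
have mf : measurable_fun setT f.
  apply/measurable_EFinP/measurable_funM; last exact: mm3.
  apply: measurable_funM; first apply: measurable_funM.
  - by apply: (measurableT_comp (measurable_indic mA)); apply: measurableT_comp.
  - by apply: (measurableT_comp (measurable_indic mB)); apply: measurableT_comp.
  - by apply: (measurableT_comp (measurable_indic mT)); exact: measurable_snd.
have f0 p : (0 <= f p)%E by rewrite lee_fin mulr_ge0// !mulr_ge0// indicE.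
have mft t : measurable_fun setT (fun p => f (p, t)).
  exact: (measurable_fun_pair1 t mf).
have sigma0 := prec_sd_neq0 beta_gt0.
apply: (@etrans _ _ (\int[mu]_t \int[mu]_s \int[mu]_u f ((s, u), t))%E); last first.
  transitivity (\int[mu2 \x mu]_p f p)%E.
    rewrite (@fubini_tonelli2 _ _ _ _ R mu2 mu f mf f0).
    apply: eq_integral => t _; apply/esym.
    by apply: (fubini_tonelli1 (fun p => f (p, t))).
  rewrite [RHS]integral_mkcond; apply: eq_integral => -[[s u] t] _.
  rewrite patchE /f /= !indicE.
  rewrite (_ : ((s, u, t) \in A `*` B `*` T) = [&& s \in A, u \in B & t \in T]); last first.
    by rewrite !in_setX /= andbA.
  by case: (s \in A); case: (u \in B); case: (t \in T); rewrite /= ?mul1r ?mul0r.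
rewrite integral_mkcond ge0_integral_normal_prob; last 2 first.
- apply/(measurable_restrictT _ _).1 => //.
  by apply/measurable_funTS/emeasurable_funM; exact: measurable_normal_prob.
- by move=> t; rewrite patchE; case: ifP => // _; rewrite mule_ge0.
apply: eq_integral => t _.
have E V : measurable V -> (normal_prob t (prec_sd beta) V =
    \int[mu]_x (\1_V x * normal_pdf t (prec_sd beta) x)%:E)%E.
  move=> mV; rewrite /normal_prob integral_mkcond; apply: eq_integral => x _.
  by rewrite patchE indicE; case: (x \in V); rewrite ?mul1r ?mul0r.
have mE V : measurable V ->
    measurable_fun setT (fun x => (\1_V x * normal_pdf t (prec_sd beta) x)%:E).
  move=> mV; apply/measurable_EFinP/measurable_funM.
    exact: measurable_indic.
  exact: measurable_normal_pdf.
have E0 V x : (0 <= (\1_V x * normal_pdf t (prec_sd beta) x)%:E)%E.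
  by rewrite lee_fin mulr_ge0 ?normal_pdf_ge0// indicE.
transitivity (\int[mu]_s ((\1_T t * normal_pdf 0 (prec_sd alpha) t)%:E *
  normal_prob t (prec_sd beta) B * (\1_A s * normal_pdf t (prec_sd beta) s)%:E))%E.
  rewrite ge0_integralZl//; last 2 first.
  - exact: mE.
  - by rewrite mule_ge0// lee_fin mulr_ge0 ?normal_pdf_ge0// indicE.
  rewrite -E// patchE indicE; case: (t \in T); rewrite ?mul1r ?mul0r ?mul0e//.
  by rewrite muleC -!muleA [(normal_prob _ _ A * _)%E]muleC.
apply: eq_integral => s _; rewrite (E B)// muleAC -ge0_integralZl//; last 2 first.
- exact: mE.
- by rewrite -EFinM lee_fin mulr_ge0// mulr_ge0 ?normal_pdf_ge0// indicE.
by apply: eq_integral => u _; rewrite -!EFinM /f /m3 /joint_pdf /=; congr EFin; ring.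
Qed.

Let weighted (F : R * R * R -> \bar R) (p : RT * RT * RT) := (F p * (m3 p)%:E)%E.

Let mweighted F : measurable_fun setT F -> measurable_fun setT (weighted F).
Proof. by move=> mF; apply: emeasurable_funM => //; exact/measurable_EFinP. Qed.

Let weighted_ge0 F p : (forall p, 0 <= F p)%E -> (0 <= weighted F p)%E.
Proof. by move=> F0; rewrite mule_ge0// lee_fin. Qed.

Let integral_law3 (F : R * R * R -> \bar R) :
  measurable_fun setT F -> (forall p, 0 <= F p)%E ->
  (\int[P]_o F (sA o, sB o, theta o) = \int[mu2 \x mu]_p weighted F p)%E.
Proof.
move=> mF F0; transitivity (\int[pushforward P X]_p F p)%E.
  by rewrite ge0_integral_pushforward//; exact: mX.
rewrite (@ge0_integral_density _ _ _ (mu2 \x mu)%E m3 mm3)//.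
exact: law_density.
Qed.

(** With the state outermost the two signals separate, which is the order in which welfare is
    computed. *)
Lemma integral_law_prior (F : R * R * R -> \bar R) :
  measurable_fun setT F -> (forall p, 0 <= F p)%E ->
  (\int[P]_o F (sA o, sB o, theta o) =
   \int[mu]_t \int[mu]_s \int[mu]_u (F (s, u, t) * (joint_pdf t s u)%:E))%E.
Proof.
move=> mF F0; rewrite (integral_law3 mF F0).
rewrite (@fubini_tonelli2 _ _ _ _ R mu2 mu _ (mweighted mF) (fun p => weighted_ge0 p F0)).
apply: eq_integral => t _.
apply: (@fubini_tonelli1 _ _ _ _ R mu mu (fun p => weighted F (p, t))).
- exact: (measurable_fun_pair1 t (mweighted mF)).
- by move=> p; exact: weighted_ge0.
Qed.

Lemma integral_law (F : R * R * R -> \bar R) :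
  measurable_fun setT F -> (forall p, 0 <= F p)%E ->
  (\int[P]_o F (sA o, sB o, theta o) =
   \int[mu]_s \int[mu]_u \int[mu]_t (F (s, u, t) * (joint_pdf t s u)%:E))%E.
Proof.
move=> mF F0; rewrite (integral_law3 mF F0).
rewrite (@fubini_tonelli1 _ _ _ _ R mu2 mu _ (mweighted mF) (fun p => weighted_ge0 p F0)).
apply: (@fubini_tonelli1 _ _ _ _ R mu mu (fubini_F mu (weighted F))).
- apply: measurable_fun_fubini_tonelli_F; first exact: mweighted.
  by move=> p; exact: weighted_ge0.
- by move=> p; apply: integral_ge0 => t _; exact: weighted_ge0.
Qed.

(** With the signals outermost the inner integral is a posterior expectation: Bayes' rule as a
    disintegration of the joint law. *)
Lemma integral_law_post (F : R * R * R -> \bar R) :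
  measurable_fun setT F -> (forall p, 0 <= F p)%E ->
  (\int[P]_o F (sA o, sB o, theta o) =
   \int[mu]_s \int[mu]_u ((signal_pdf s u)%:E *
     \int[normal_prob (post_mean2 s u) (prec_sd tau)]_t F (s, u, t)))%E.
Proof.
move=> mF F0; rewrite (integral_law mF F0); apply: eq_integral => s _.
apply: eq_integral => u _.
have mFsu : measurable_fun setT (fun t => F (s, u, t)).
  exact: (measurable_fun_pair2 (s, u) mF).
rewrite ge0_integral_normal_prob// -ge0_integralZl//.
- by apply: eq_integral => t _; rewrite joint_pdfE muleCA -EFinM.
- apply: emeasurable_funM => //.
  by apply/measurable_EFinP; exact: measurable_normal_pdf.
- by move=> t _; rewrite mule_ge0// lee_fin normal_pdf_ge0.
- by rewrite lee_fin ltW// signal_pdf_gt0.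
Qed.

Lemma integral_law_signals (G : R * R -> \bar R) :
  measurable_fun setT G -> (forall p, 0 <= G p)%E ->
  (\int[P]_o G (sA o, sB o) =
   \int[mu]_s \int[mu]_u (G (s, u) * (signal_pdf s u)%:E))%E.
Proof.
move=> mG G0.
have mG1 : measurable_fun setT (fun p : R * R * R => G p.1).
  exact: measurableT_comp.
rewrite (integral_law mG1 (fun p => G0 p.1)).
apply: eq_integral => s _; apply: eq_integral => u _ /=.
rewrite ge0_integralZl//.
- by rewrite integral_joint_pdf.
- by apply/measurable_EFinP; exact: measurable_joint_pdf.
- by move=> t _; rewrite lee_fin joint_pdf_ge0.
Qed.

End JointLaw.

(** * Posterior means *)

Section Posterior.
Context (R : realType) (alpha beta : R) (alpha_gt0 : 0 < alpha) (beta_gt0 : 0 < beta).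
Local Notation mu := (@lebesgue_measure R).
Local Notation lik ss := (fun t => \prod_(s <- ss) normal_pdf t (prec_sd beta) s).

Lemma measurable_lik (ss : seq R) : measurable_fun setT (lik ss).
Proof.
apply: measurable_prod => s _.
by apply: measurable_normal_pdf_comp => //; exact: prec_sd_neq0.
Qed.

Lemma integral_prior_lik (ss : seq R) (K m sigma : R) (h : R -> R) : sigma != 0 ->
  (forall t, normal_pdf 0 (prec_sd alpha) t * lik ss t = K * normal_pdf m sigma t) ->
  measurable_fun setT h -> (normal_prob m sigma).-integrable setT (EFin \o h) ->
  (\int[normal_prob 0 (prec_sd alpha)]_t (h t * lik ss t)%:E =
   K%:E * \int[normal_prob m sigma]_t (h t)%:E)%E.
Proof.
move=> sigma0 KE mh ih; apply: (etrans _ (integralZl measurableT ih K)).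
rewrite integral_normal_prob; last first.
  by apply/measurable_EFinP/measurable_funM => //; exact: measurable_lik.
rewrite integral_normal_prob; last first.
  by apply/measurable_EFinP/measurable_funM.
apply: eq_integral => t _; move: (KE t) => /=; set p := \prod_(_ <- _) _ => KEt.
rewrite -!EFinM; congr EFin.
have aux (x p0 a k n : R) : a * p0 = k * n -> x * p0 * a = k * x * n.
  by move=> e; rewrite -mulrA [p0 * a]mulrC e; ring.
exact: aux.
Qed.

(** The factor K, which carries all the dependence on normalisation, cancels between numerator and
    denominator of Bayes' rule. *)
Lemma posterior_conj (ss : seq R) (K m sigma : R) (h : R -> R) :
  K != 0 -> sigma != 0 ->
  (forall t, normal_pdf 0 (prec_sd alpha) t * lik ss t = K * normal_pdf m sigma t) ->
  measurable_fun setT h -> (normal_prob m sigma).-integrable setT (EFin \o h) ->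
  posterior alpha beta ss h = \int[normal_prob m sigma]_t h t.
Proof.
move=> K0 sigma0 KE mh ih; rewrite /posterior.
have E1 : \int[normal_prob 0 (prec_sd alpha)]_t lik ss t = K.
  rewrite /Rintegral; under eq_integral do rewrite -[lik ss _]mul1r.
  rewrite (integral_prior_lik (h := cst 1) sigma0 KE)//.
    by rewrite integral_normal_prob_cst mule1.
  exact: finite_measure_integrable_cst.
rewrite E1 /Rintegral (integral_prior_lik sigma0 KE mh ih) fineM//; last first.
  exact: integrable_fin_num.
by rewrite /= mulrC mulKf.
Qed.

Lemma posterior_mean1 (s : R) :
  posterior_mean alpha beta [:: s] = beta * s / (alpha + beta).
Proof.
have ab0 := addr_gt0 alpha_gt0 beta_gt0.
rewrite /posterior_mean.
have KE t := normal_pdf_mul 0 s t alpha_gt0 beta_gt0.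
have sab0 := prec_sd_neq0 ab0.
set K := _ * expR _ in KE.
rewrite (@posterior_conj [:: s] K ((alpha * 0 + beta * s) / (alpha + beta))
  (prec_sd (alpha + beta)) id _ sab0 _ _ (integrable_normal_prob_id _ sab0)) //; last first.
- by move=> t; rewrite big_seq1; exact: KE.
- by rewrite gt_eqF// mulr_gt0 ?expR_gt0// divr_gt0 ?mulr_gt0//;
    rewrite normal_peak_gt0// prec_sd_neq0.
by rewrite /Rintegral integral_normal_prob_id//= mulr0 add0r.
Qed.

Lemma posterior_mean2 (s u : R) :
  posterior_mean alpha beta [:: s; u] = post_mean2 alpha beta s u.
Proof.
have t0 := tau_gt0 alpha_gt0 beta_gt0.
rewrite /posterior_mean.
rewrite (posterior_conj (K := signal_pdf alpha beta s u) (m := post_mean2 alpha beta s u)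
  (sigma := prec_sd (alpha + 2 * beta))).
- by rewrite /Rintegral integral_normal_prob_id ?prec_sd_neq0.
- by rewrite gt_eqF// signal_pdf_gt0.
- exact: prec_sd_neq0.
- by move=> t; rewrite big_cons big_seq1 mulrA -joint_pdfE.
- by [].
- by apply: integrable_normal_prob_id; exact: prec_sd_neq0.
Qed.

(** The ex-ante density of a single signal, written as the denominator that occurs in [posterior]
    for a one-signal list. *)
Definition marginal_pdf (s : R) : R :=
  \int[normal_prob 0 (prec_sd alpha)]_t normal_pdf t (prec_sd beta) s.

Lemma integral_prior_pdf (s : R) :
  (\int[normal_prob 0 (prec_sd alpha)]_t (normal_pdf t (prec_sd beta) s)%:E =
   (marginal_pdf s)%:E)%E /\ 0 < marginal_pdf s.
Proof.
have ab0 := addr_gt0 alpha_gt0 beta_gt0.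
have KE t := normal_pdf_mul 0 s t alpha_gt0 beta_gt0.
set K := _ * expR _ in KE.
have K0 : 0 < K.
  rewrite mulr_gt0 ?expR_gt0// divr_gt0 ?mulr_gt0//;
    by rewrite normal_peak_gt0// prec_sd_neq0.
have E : (\int[normal_prob 0 (prec_sd alpha)]_t (normal_pdf t (prec_sd beta) s)%:E = K%:E)%E.
  transitivity (\int[normal_prob 0 (prec_sd alpha)]_t
      (cst 1 t * \prod_(u <- [:: s]) normal_pdf t (prec_sd beta) u)%:E)%E.
    by apply: eq_integral => t _; rewrite mul1r big_seq1.
  rewrite (@integral_prior_lik [:: s] K ((alpha * 0 + beta * s) / (alpha + beta))
    (prec_sd (alpha + beta)) (cst 1)).
  - by rewrite integral_normal_prob_cst mule1.
  - exact: prec_sd_neq0.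
  - by move=> t; rewrite big_seq1; exact: KE.
  - by [].
  - exact: finite_measure_integrable_cst.
by rewrite /marginal_pdf /Rintegral E.
Qed.

Lemma posterior1E (h : R -> R) (s : R) : posterior alpha beta [:: s] h =
  (\int[normal_prob 0 (prec_sd alpha)]_t (h t * normal_pdf t (prec_sd beta) s)) /
  marginal_pdf s.
Proof.
pose F (l : R -> R) := (\int[normal_prob 0 (prec_sd alpha)]_t (h t * l t)) /
  (\int[normal_prob 0 (prec_sd alpha)]_t l t).
rewrite -[LHS]/(F (fun t => \prod_(u <- [:: s]) normal_pdf t (prec_sd beta) u)).
rewrite (_ : (fun t => _) = (fun t => normal_pdf t (prec_sd beta) s))//.
by apply/funext => t; rewrite big_seq1.
Qed.

(** Interim winning probabilities become integrals against the joint signal density, up to a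
    positive factor depending only on the own signal. Best-response inequalities can therefore be
    read in terms of [signal_pdf]. *)
Lemma integral_signal_pdf (g : R -> R) (s : R) :
  measurable_fun setT g -> (forall u, 0 <= g u <= 1) ->
  (\int[mu]_u (g u * signal_pdf alpha beta s u)%:E =
   (marginal_pdf s * posterior alpha beta [:: s]
      (fun t => \int[normal_prob t (prec_sd beta)]_u g u))%:E)%E.
Proof.
move=> mg g01.
have g0 u : 0 <= g u by case/andP: (g01 u).
have g1 u : g u <= 1 by case/andP: (g01 u).
have sb0 := prec_sd_neq0 beta_gt0.
have sa0 := prec_sd_neq0 alpha_gt0.
pose G t := (\int[normal_prob t (prec_sd beta)]_u (g u)%:E)%E.
have mgE : measurable_fun setT (EFin \o g) by exact/measurable_EFinP.
have G0 t : (0 <= G t)%E by apply: integral_ge0 => u _; rewrite lee_fin.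
have G1 t : (G t <= 1)%E.
  rewrite -(integral_normal_prob_cst t (prec_sd beta) 1).
  by apply: ge0_le_integral => // u _; rewrite lee_fin.
have Gfin t : G t \is a fin_num.
  by rewrite ge0_fin_numE// (le_lt_trans (G1 t)) ?ltry.
pose k (p : measurableTypeR R * measurableTypeR R) : \bar R :=
  ((g p.2)%:E * (normal_pdf p.1 (prec_sd beta) p.2)%:E)%E.
have mk : measurable_fun setT k.
  apply: emeasurable_funM; first by apply: (measurableT_comp mgE); exact: measurable_snd.
  apply/measurable_EFinP; apply: measurable_normal_pdf_comp => //.
have k0 p : (0 <= k p)%E by rewrite mule_ge0// lee_fin// normal_pdf_ge0.
have GE : G = fubini_F mu k.
  apply/funext => t; rewrite /G ge0_integral_normal_prob//.
have hE : (fun t : R => \int[normal_prob t (prec_sd beta)]_u g u) = fine \o G by [].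
clearbody G.
have mG : measurable_fun setT G.
  by rewrite GE; exact: measurable_fun_fubini_tonelli_F.
have [M0 M1] := integral_prior_pdf s.
have mpdf : measurable_fun setT (fun t => (normal_pdf t (prec_sd beta) s)%:E).
  by apply/measurable_EFinP/measurable_normal_pdf_comp.
have numE : (\int[normal_prob 0 (prec_sd alpha)]_t (G t * (normal_pdf t (prec_sd beta) s)%:E) =
   \int[mu]_u (g u * signal_pdf alpha beta s u)%:E)%E.
  rewrite ge0_integral_normal_prob//; last 2 first.
  - exact: emeasurable_funM.
  - by move=> t; rewrite mule_ge0// lee_fin normal_pdf_ge0.
  pose j (p : measurableTypeR R * measurableTypeR R) : \bar R :=
    ((g p.2)%:E * (joint_pdf alpha beta p.1 s p.2)%:E)%E.
  have mj : measurable_fun setT j.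
    apply: emeasurable_funM; first by apply: (measurableT_comp mgE); exact: measurable_snd.
    by apply/measurable_EFinP; apply: measurable_joint_pdf.
  have j0 p : (0 <= j p)%E by rewrite mule_ge0// lee_fin// joint_pdf_ge0.
  transitivity (\int[mu]_t \int[mu]_u j (t, u))%E.
    apply: eq_integral => t _; rewrite GE /fubini_F -muleA muleC -ge0_integralZl//.
    - apply: eq_integral => u _; rewrite /k /j /joint_pdf /= -!EFinM.
      by congr EFin; ring.
    - exact: (measurable_fun_pair2 t mk).
    - by rewrite mule_ge0// lee_fin normal_pdf_ge0.
  rewrite (fubini_tonelli j mj j0); apply: eq_integral => u _.
  rewrite /j /= ge0_integralZl//.
  - by rewrite integral_joint_pdf.
  - by apply/measurable_EFinP; apply: measurable_joint_pdf.
  - by move=> t _; rewrite lee_fin joint_pdf_ge0.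
  - by rewrite lee_fin.
have numle : (\int[normal_prob 0 (prec_sd alpha)]_t
    (G t * (normal_pdf t (prec_sd beta) s)%:E) <= (marginal_pdf s)%:E)%E.
  rewrite -M0; apply: ge0_le_integral => //.
  - by move=> t _; rewrite mule_ge0// lee_fin normal_pdf_ge0.
  - exact: emeasurable_funM.
  - by move=> t _; rewrite -[leRHS]mul1e lee_wpmul2r// lee_fin normal_pdf_ge0.
have numfin : (\int[normal_prob 0 (prec_sd alpha)]_t
    (G t * (normal_pdf t (prec_sd beta) s)%:E))%E \is a fin_num.
  rewrite ge0_fin_numE; first by rewrite (le_lt_trans numle) ?ltry.
  by apply: integral_ge0 => t _; rewrite mule_ge0// lee_fin normal_pdf_ge0.
rewrite -numE.
(* [fine] would silently replace an infinite numerator by 0. The bound by [marginal_pdf s] excludes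
   this. *)
have aux (A B : \bar R) (c : R) : c != 0 -> A \is a fin_num -> B = A ->
    A = (c * (fine B / c))%:E.
  by move=> c0 Af ->; rewrite mulrC divfK// fineK.
rewrite hE posterior1E; apply: aux => //; first by rewrite gt_eqF.
by apply: eq_integral => t _; rewrite EFinM /= fineK.
Qed.

End Posterior.

(** * Completeness of the normal signal kernel *)

Section ExpSeries.
Context (R : realType).

Lemma series_exp_coeff_le_expR (x : R) n : `|series (exp_coeff x) n| <= expR `|x|.
Proof.
apply: (@le_trans _ _ (series (exp_coeff `|x|) n)).
  rewrite -normed_series_exp_coeff; exact: ler_norm_sum.
apply: nondecreasing_cvgn_le; last exact: is_cvg_series_exp_coeff.
by apply: nondecreasing_series => i _ _; exact: exp_coeff_ge0.
Qed.

Lemma exp_coeff_le_expR (x : R) n : `|x| ^+ n <= n`!%:R * expR `|x|.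
Proof.
rewrite mulrC -ler_pdivrMr ?ltr0n ?fact_gt0//.
have h := le_trans (ler_norm _) (series_exp_coeff_le_expR `|x| n.+1).
rewrite normr_id in h; apply: le_trans h.
rewrite /series/= big_nat_recr//= lerDr sumr_ge0// => i _.
exact: exp_coeff_ge0.
Qed.

Context d (T : measurableType d) (m : {measure set T -> \bar R}) (k x : T -> R).
Hypotheses (mk : measurable_fun setT k) (mx : measurable_fun setT x).
Hypothesis ikx : m.-integrable setT (fun t => (k t * expR `|x t|)%:E).

Let norm_ikx : m.-integrable setT (fun t => (`|k t| * expR `|x t|)%:E).
Proof.
have := integrable_norm ikx; apply: eq_integrable => // t _ /=.
by rewrite normrM [`|expR _|]ger0_norm ?expR_ge0.
Qed.

Lemma integrable_exp_term n : m.-integrable setT (fun t => (k t * x t ^+ n)%:E).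
Proof.
have i2 := integrableZl measurableT n`!%:R norm_ikx.
apply: (le_integrable measurableT _ _ i2).
  by apply/measurable_EFinP/measurable_funM => //; apply: measurable_funX.
move=> t _ /=; rewrite lee_fin normrM normrX [leRHS]ger0_norm; last first.
  by rewrite !mulr_ge0// expR_ge0.
by rewrite mulrCA ler_wpM2l// exp_coeff_le_expR.
Qed.

Lemma integral_exp_partial n :
  (\int[m]_t (k t * series (exp_coeff (x t)) n)%:E =
   \sum_(0 <= i < n) ((i`!%:R)^-1)%:E * \int[m]_t (k t * x t ^+ i)%:E)%E.
Proof.
transitivity (\int[m]_t (\sum_(0 <= i < n) ((i`!%:R)^-1)%:E * (k t * x t ^+ i)%:E))%E.
  apply: eq_integral => t _; rewrite /series/= mulr_sumr -sumEFin.
  by apply: eq_bigr => i _; rewrite -EFinM /exp_coeff/=; congr EFin; ring.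
rewrite integral_sum//.
  by apply: eq_bigr => i _; rewrite integralZl//; exact: integrable_exp_term.
by move=> i; apply: integrableZl => //; exact: integrable_exp_term.
Qed.

Lemma cvg_integral_exp :
  (\int[m]_t (k t * series (exp_coeff (x t)) n)%:E)%E @[n --> \oo] -->
  (\int[m]_t (k t * expR (x t))%:E)%E.
Proof.
have ms n : measurable_fun setT (fun t => (k t * series (exp_coeff (x t)) n)%:E).
  apply/measurable_EFinP/measurable_funM => //; rewrite /series/=.
  apply: measurable_sum => i; apply: measurable_funM => //; exact: measurable_funX.
apply: (@dominated_cvg _ _ _ m _ measurableT _ _ (fun t => (`|k t| * expR `|x t|)%:E)) => //.
- move=> t _; apply: cvg_EFin; first exact: nearW.
  apply: cvgM; first exact: cvg_cst.
  exact: is_cvg_series_exp_coeff.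
- by move=> n t _; rewrite lee_fin normrM ler_wpM2l// series_exp_coeff_le_expR.
Qed.

Lemma integral_exp_eq0 :
  (forall n, \int[m]_t (k t * x t ^+ n)%:E = 0)%E ->
  (\int[m]_t (k t * expR (x t))%:E = 0)%E.
Proof.
move=> k0; have /cvg_lim <- := cvg_integral_exp => //.
rewrite (_ : (fun n => _) = cst 0%E) ?lim_cst//.
by apply/funext => n; rewrite integral_exp_partial big1// => i _; rewrite k0 mule0.
Qed.

(** The integral of the exponential is the sum of the moments divided by factorials, and a vanishing
    series of nonnegative terms has only zero terms. *)
Lemma integral_exp_term_eq0 :
  (forall n, 0 <= \int[m]_t (k t * x t ^+ n)%:E)%E ->
  (\int[m]_t (k t * expR (x t))%:E = 0)%E ->
  (forall n, \int[m]_t (k t * x t ^+ n)%:E = 0)%E.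
Proof.
move=> k0 e0 n; apply/eqP; rewrite eq_le k0 andbT.
pose u i := (((i`!%:R : R)^-1)%:E * \int[m]_t (k t * x t ^+ i)%:E)%E.
have u0 i : (0 <= u i)%E by rewrite mule_ge0// lee_fin invr_ge0.
have cu : (\sum_(0 <= i < j) u i)%E @[j --> \oo] --> 0%E.
  have := cvg_integral_exp; rewrite e0; under eq_fun do rewrite integral_exp_partial.
  by [].
have : (\sum_(0 <= i < n.+1) u i <= 0)%E.
  have e : limn (fun j => \sum_(0 <= i < j) u i)%E = 0%E by exact: cvg_lim.
  by rewrite -[X in (_ <= X)%E]e; exact: (nneseries_lim_ge n.+1 (fun i _ _ => u0 i)).
rewrite big_nat_recr//= => h.
have : (u n <= 0)%E.
  by apply: le_trans h; rewrite leeDr// sume_ge0.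
by rewrite /u pmule_rle0// lte_fin invr_gt0 ltr0n fact_gt0.
Qed.

End ExpSeries.

(** * Moments under Gaussian weights *)

Section GaussianBound.
Context (R : realType).
Local Notation mu := (@lebesgue_measure R).

Lemma integrable_gauss (delta : R) : 0 < delta ->
  mu.-integrable setT (fun u => (expR (- delta * u ^+ 2))%:E).
Proof.
move=> d0; have d20 : 0 < 2 * delta by rewrite mulr_gt0.
have p0 := normal_peak_gt0 (prec_sd_neq0 d20).
have := integrableZl measurableT (normal_peak (prec_sd (2 * delta)))^-1
  (integrable_normal_pdf 0 (prec_sd (2 * delta))).
apply: eq_integrable => // u _; rewrite normal_pdf_prec// -EFinM mulKf ?gt_eqF//.
have -> : 2 * delta / 2 = delta by field.
by rewrite subr0.
Qed.

Lemma integrable_gauss_bounded (delta C : R) (f : R -> R) : 0 < delta ->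
  measurable_fun setT f -> (forall u, `|f u| <= C * expR (- delta * u ^+ 2)) ->
  mu.-integrable setT (EFin \o f).
Proof.
move=> d0 mf fC.
have iC := integrableZl measurableT C (integrable_gauss d0).
apply: (le_integrable measurableT _ _ iC); first exact/measurable_EFinP.
move=> u _ /=; rewrite lee_fin; apply: le_trans (fC u) _; exact: ler_norm.
Qed.

Lemma pow_exp_gauss_bounded (delta c : R) n : 0 < delta -> exists2 C, 0 <= C &
  forall u : R, `|u| ^+ n * expR (c * `|u|) * expR (- delta * u ^+ 2) <=
    C * expR (- (delta / 2) * u ^+ 2).
Proof.
move=> d0; exists (n`!%:R * expR ((1 + c) ^+ 2 / (2 * delta))).
  by rewrite mulr_ge0// expR_ge0.
move=> u; apply: (@le_trans _ _ (n`!%:R * expR `|u| * expR (c * `|u|) *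
    expR (- delta * u ^+ 2))).
  by rewrite !ler_wpM2r ?expR_ge0// exp_coeff_le_expR.
rewrite -!mulrA ler_wpM2l// -!expRD ler_expR -real_normK ?num_real//.
move: `|u| => v; rewrite -subr_ge0.
have -> : (1 + c) * ((1 + c) / (2 * delta)) + - (delta / 2) * v ^+ 2 -
    (v + (c * v + - delta * v ^+ 2)) = (delta * v - (1 + c)) ^+ 2 / (2 * delta).
  by field; rewrite gt_eqF.
by rewrite divr_ge0 ?sqr_ge0// mulr_ge0// ltW.
Qed.

(* Multiplying by [expR (- mu * u ^+ 2)] with [mu < delta] is an absolutely
   convergent power series in the moments of f, so vanishing moments are
   inherited by the narrower weight. *)
Lemma moments_eq0_narrow (delta C : R) (f : R -> R) : 0 < delta ->
  measurable_fun setT f -> (forall u, `|f u| <= C * expR (- delta * u ^+ 2)) ->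
  (forall n, \int[mu]_u (f u * u ^+ n)%:E = 0)%E ->
  (forall n, \int[mu]_u (f u * expR (- (delta / 2) * u ^+ 2) * u ^+ n)%:E = 0)%E.
Proof.
move=> d0 mf fC f0 n.
have mx : measurable_fun setT (fun u : R => - (delta / 2) * u ^+ 2).
  by apply: measurable_funM => //; exact: measurable_funX.
have mk : measurable_fun setT (fun u : R => f u * u ^+ n).
  by apply: measurable_funM => //; exact: measurable_funX.
have d20 : 0 < delta / 2 by rewrite divr_gt0.
have d40 : 0 < delta / 2 / 2 by rewrite divr_gt0.
transitivity (\int[mu]_u ((f u * u ^+ n) * expR (- (delta / 2) * u ^+ 2))%:E)%E.
  by apply: eq_integral => u _; rewrite mulrAC.
(* Only half of [delta] is spent: the series of absolute values sums to exp (delta / 2 * u ^+ 2),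
   and what remains of the bound on f is still Gaussian. *)
apply: integral_exp_eq0 => //.
  have [C' C'0 H] := pow_exp_gauss_bounded 0 n d20.
  apply: (@integrable_gauss_bounded _ (C * C') _ d40) => [|u].
    by apply: measurable_funM => //; apply: measurableT_comp => //; exact: measurableT_comp.
  have nx : `|- (delta / 2) * u ^+ 2| = delta / 2 * u ^+ 2.
    by rewrite mulNr normrN ger0_norm// mulr_ge0 ?sqr_ge0// ltW.
  rewrite nx !normrM normrX [`|expR _|]ger0_norm ?expR_ge0//.
  have C0 : 0 <= C.
    by have := le_trans (normr_ge0 _) (fC 0); rewrite pmulr_lge0// expR_gt0.
  apply: le_trans (_ : C * (`|u| ^+ n * expR (0 * `|u|) * expR (- (delta / 2) * u ^+ 2)) <= _).
    rewrite mul0r expR0 mulr1 -mulrA.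
    apply: le_trans (_ : (C * expR (- delta * u ^+ 2)) * (`|u| ^+ n * expR (delta / 2 * u ^+ 2)) <= _).
      by rewrite ler_wpM2r// mulr_ge0 ?expR_ge0// exprn_ge0.
    rewrite mulrCA -!mulrA -expRD mulrCA ler_wpM2l// ler_wpM2l ?exprn_ge0//.
    by rewrite ler_expR; lra.
  by rewrite -[X in _ <= X]mulrA ler_wpM2l.
move=> i; transitivity (\int[mu]_u (((- (delta / 2)) ^+ i)%:E * (f u * u ^+ (n + 2 * i))%:E))%E.
  by apply: eq_integral => u _; rewrite -EFinM exprD exprM exprMn; congr EFin; ring.
rewrite integralZl ?f0 ?mule0//.
have [C' C'0 H] := pow_exp_gauss_bounded 0 (n + 2 * i) d0.
apply: (@integrable_gauss_bounded _ (C * C') _ d20) => [|u].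
  by apply: measurable_funM => //; exact: measurable_funX.
rewrite normrM normrX.
have C0 : 0 <= C.
  by have := le_trans (normr_ge0 _) (fC 0); rewrite pmulr_lge0// expR_gt0.
apply: le_trans (_ : C * (`|u| ^+ (n + 2 * i) * expR (0 * `|u|) * expR (- delta * u ^+ 2)) <= _).
  rewrite mul0r expR0 mulr1 mulrCA [X in _ <= X]mulrC.
  by rewrite ler_wpM2r ?exprn_ge0.
by rewrite -[X in _ <= X]mulrA ler_wpM2l.
Qed.

(** A linear exponent moves the centre of the Gaussian weight. Its expansion is again a series of
    moments of f. *)
Lemma moments_eq0_tilt (delta C : R) (f : R -> R) (c : R) : 0 < delta ->
  measurable_fun setT f -> (forall u, `|f u| <= C * expR (- delta * u ^+ 2)) ->
  (forall n, \int[mu]_u (f u * u ^+ n)%:E = 0)%E ->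
  (\int[mu]_u (f u * expR (c * u))%:E = 0)%E.
Proof.
move=> d0 mf fC f0.
have d20 : 0 < delta / 2 by rewrite divr_gt0.
have C0 : 0 <= C.
  by have := le_trans (normr_ge0 _) (fC 0); rewrite pmulr_lge0// expR_gt0.
have mx : measurable_fun setT (fun u : R => c * u) by exact: measurable_funM.
apply: integral_exp_eq0 => //.
  have [C' C'0 H] := pow_exp_gauss_bounded `|c| 0 d0.
  apply: (@integrable_gauss_bounded _ (C * C') _ d20) => [|u].
    by apply: measurable_funM => //; apply: measurableT_comp => //; exact: measurableT_comp.
  rewrite normrM [`|expR _|]ger0_norm ?expR_ge0// normrM.
  apply: le_trans (_ : C * (`|u| ^+ 0 * expR (`|c| * `|u|) * expR (- delta * u ^+ 2)) <= _).
    rewrite expr0 mul1r mulrCA [X in _ <= X]mulrC.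
    by rewrite ler_wpM2r ?expR_ge0.
  by rewrite -[X in _ <= X]mulrA ler_wpM2l.
move=> i; transitivity (\int[mu]_u ((c ^+ i)%:E * (f u * u ^+ i)%:E))%E.
  by apply: eq_integral => u _; rewrite -EFinM exprMn; congr EFin; ring.
rewrite integralZl ?f0 ?mule0//.
have [C' C'0 H] := pow_exp_gauss_bounded 0 i d0.
apply: (@integrable_gauss_bounded _ (C * C') _ d20) => [|u].
  by apply: measurable_funM => //; exact: measurable_funX.
rewrite normrM normrX.
apply: le_trans (_ : C * (`|u| ^+ i * expR (0 * `|u|) * expR (- delta * u ^+ 2)) <= _).
  rewrite mul0r expR0 mulr1 mulrCA [X in _ <= X]mulrC.
  by rewrite ler_wpM2r ?exprn_ge0.
by rewrite -[X in _ <= X]mulrA ler_wpM2l.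
Qed.

Let quad (s u : R) : R := s ^+ 2 + u ^+ 2.

Let cross_le (l s u : R) : 0 < l -> l * `|s * u| <= l / 2 * quad s u.
Proof.
move=> l0; rewrite /quad -subr_ge0 normrM -(real_normK (num_real s)) -(real_normK (num_real u)).
move: `|s| `|u| => {}s {}u.
rewrite (_ : _ - _ = l / 2 * (s - u) ^+ 2); last by field.
by rewrite mulr_ge0 ?sqr_ge0// divr_ge0// ltW.
Qed.

(* [expR (l * (s * u))] is a positive definite kernel: integrating the
   hypothesis against [D s] gives the sum over n of [l ^+ n / n`!] times the
   square of the n-th moment. *)
Lemma moments_eq0_of_kernel (D : R -> R) (delta l : R) : 0 < l -> l < 2 * delta ->
  measurable_fun setT D -> (forall u, `|D u| <= 1) ->
  {ae mu, forall s, (\int[mu]_u (D u * expR (- delta * (s ^+ 2 + u ^+ 2) + l * (s * u)))%:E = 0)%E} ->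
  (forall n, \int[mu]_u (D u * expR (- delta * u ^+ 2) * u ^+ n)%:E = 0)%E.
Proof.
move=> l0 ld mD D1 ae0.
have d0 : 0 < delta by lra.
have dl0 : 0 < delta - l / 2 by lra.
pose f (u : R) : R := D u * expR (- delta * u ^+ 2).
have mf : measurable_fun setT f.
  by apply: measurable_funM => //; apply: measurableT_comp => //; apply: measurable_funM => //; exact: measurable_funX.
have fC u : `|f u| <= 1 * expR (- delta * u ^+ 2).
  by rewrite /f normrM [`|expR _|]ger0_norm ?expR_ge0// ler_wpM2r ?expR_ge0.
have imom n : mu.-integrable setT (fun u => (f u * u ^+ n)%:E).
  have [C' C'0 H] := pow_exp_gauss_bounded 0 n d0.
  have d20 : 0 < delta / 2 by rewrite divr_gt0.
  apply: (@integrable_gauss_bounded _ C' _ d20) => [|u].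
    by apply: measurable_funM => //; exact: measurable_funX.
  apply: le_trans (H u); rewrite mul0r expR0 mulr1 normrM normrX mulrC.
  by rewrite ler_wpM2l ?exprn_ge0// -[leRHS]mul1r.
pose mom n := fine (\int[mu]_u (f u * u ^+ n)%:E)%E.
have momE n : (\int[mu]_u (f u * u ^+ n)%:E)%E = (mom n)%:E.
  by rewrite /mom fineK//; exact: integrable_fin_num.
pose k (p : measurableTypeR R * measurableTypeR R) : R := f p.1 * f p.2.
pose x (p : measurableTypeR R * measurableTypeR R) : R := l * (p.1 * p.2).
have mk : measurable_fun setT k.
  apply: measurable_funM; first by apply: (measurableT_comp mf); exact: measurable_fst.
  by apply: (measurableT_comp mf); exact: measurable_snd.
have mx : measurable_fun setT x.
  apply: measurable_funM => //; apply: measurable_funM; first exact: measurable_fst.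
  exact: measurable_snd.
have ikx : (mu \x mu)%E.-integrable setT (fun p => (k p * expR `|x p|)%:E).
  (* Here l < 2 * delta is decisive: as l |s u| <= l / 2 (s ^+ 2 + u ^+ 2), the absolute integrand
     is at most g s * g u, where g is Gaussian of positive rate delta - l / 2. *)
  pose g (u : R) := expR (- (delta - l / 2) * u ^+ 2).
  have mg : measurable_fun setT g.
    by apply: measurableT_comp => //; apply: measurable_funM => //; exact: measurable_funX.
  have ig : mu.-integrable setT (EFin \o g) by exact: integrable_gauss.
  pose gg (p : measurableTypeR R * measurableTypeR R) : \bar R := (g p.1 * g p.2)%:E.
  have mgg : measurable_fun setT gg.
    apply/measurable_EFinP/measurable_funM.
      by apply: (measurableT_comp mg); exact: measurable_fst.
    by apply: (measurableT_comp mg); exact: measurable_snd.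
  have igg : (mu \x mu)%E.-integrable setT gg.
    apply/(integrable12ltyP _ _ mgg).2.
    under eq_integral => s _.
      under eq_integral => u _ do rewrite /gg/= normrM EFinM.
      rewrite integralZl//; last first.
        exact: (integrable_norm ig).
      over.
    have /integrableP[_ lt] := ig.
    rewrite ge0_integralZr//; last 2 first.
    - by apply/measurable_EFinP; exact: measurableT_comp.
    - exact: integral_ge0.
    rewrite lte_mul_pinfty//.
    - exact: integral_ge0.
    - by rewrite ge0_fin_numE//; exact: integral_ge0.
  apply: (le_integrable measurableT _ _ igg).
    by apply/measurable_EFinP/measurable_funM => //; apply: measurableT_comp => //; exact: measurableT_comp.
  move=> -[s u] _ /=; rewrite lee_fin /k /x/= [leRHS]ger0_norm ?mulr_ge0 ?expR_ge0//.
  rewrite normrM [`|expR _|]ger0_norm ?expR_ge0// [`|f s * f u|]normrM.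
  apply: le_trans (_ : (1 * expR (- delta * s ^+ 2)) * (1 * expR (- delta * u ^+ 2)) *
    expR (l / 2 * quad s u) <= _).
    rewrite ler_pM ?mulr_ge0 ?expR_ge0//.
      by apply: ler_pM => //; exact: fC.
    by rewrite ler_expR normrM gtr0_norm// cross_le.
  by rewrite !mul1r /g -!expRD ler_expR /quad; lra.
have term n : (\int[mu \x mu]_p (k p * x p ^+ n)%:E)%E = (l ^+ n * mom n ^+ 2)%:E.
  rewrite -integral12_prod_meas1; last exact: integrable_exp_term.
  transitivity (\int[mu]_s ((l ^+ n * mom n)%:E * (f s * s ^+ n)%:E))%E.
    apply: eq_integral => s _; rewrite /fubini_F.
    transitivity (\int[mu]_u ((l ^+ n * (f s * s ^+ n))%:E * (f u * u ^+ n)%:E))%E.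
      by apply: eq_integral => u _; rewrite -EFinM /k /x/= !exprMn; congr EFin; ring.
    by rewrite integralZl// momE -!EFinM; congr EFin; ring.
  by rewrite integralZl// momE -EFinM; congr EFin; ring.
(* Integrating first over u makes the inner integral vanish for almost every s, which suffices for
   the double integral. *)
have sum0 : (\int[mu \x mu]_p (k p * expR (x p))%:E = 0)%E.
  have ikxe : (mu \x mu)%E.-integrable setT (fun p => (k p * expR (x p))%:E).
    apply: (le_integrable measurableT _ _ ikx).
      by apply/measurable_EFinP/measurable_funM => //; exact: measurableT_comp.
    move=> p _ /=; rewrite lee_fin normrM [leRHS]normrM ler_wpM2l//.
    rewrite [leLHS]ger0_norm ?expR_ge0// [leRHS]ger0_norm ?expR_ge0//.
    by rewrite ler_expR ler_norm.
  rewrite -integral12_prod_meas1//.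
  rewrite (ae_eq_integral (cst 0%E))//; first by rewrite integral0.
  - exact: (measurable_fubini_F ikxe).
  - apply: (@filterS _ _ (ae_filter_ringOfSetsType mu) _ _ _ ae0) => s hs _; rewrite /fubini_F /=.
    transitivity (\int[mu]_u ((D s)%:E * (D u * expR (- delta * (s ^+ 2 + u ^+ 2) + l * (s * u)))%:E))%E.
      apply: eq_integral => u _; rewrite /k /x /f/= -EFinM; congr EFin.
      by rewrite mulrDr !expRD; ring.
    rewrite integralZl ?hs ?mule0//.
    apply: (@integrable_gauss_bounded _ 1 _ dl0) => [|u].
      apply: measurable_funM => //; apply: measurableT_comp => //.
      apply: measurable_funD.
        by apply: measurable_funM => //; apply: measurable_funD => //; exact: measurable_funX.
      by apply: measurable_funM => //; exact: measurable_funM.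
    rewrite normrM [`|expR _|]ger0_norm ?expR_ge0// mul1r.
    apply: le_trans (_ : 1 * expR (- delta * (s ^+ 2 + u ^+ 2) + l * (s * u)) <= _).
      by rewrite ler_wpM2r ?expR_ge0.
    rewrite mul1r ler_expR; have := cross_le s u l0.
    have := ler_norm (s * u); have := sqr_ge0 s; rewrite /quad; nra.
have mom0 n : (\int[mu \x mu]_p (k p * x p ^+ n)%:E = 0)%E.
  apply: (integral_exp_term_eq0 mk mx ikx) => // i.
  by rewrite term lee_fin mulr_ge0 ?sqr_ge0// exprn_ge0// ltW.
move=> n; rewrite -/(f _) momE; congr EFin; apply/eqP.
have := mom0 n; rewrite term => -[] /eqP.
by rewrite mulf_eq0 expf_eq0 (gt_eqF l0) andbF/= sqrf_eq0.
Qed.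

(** The moments yield orthogonality to arbitrarily narrow normal densities about any point a. This
    localises D without a determinacy theorem for moments. *)
Lemma kernel_complete (D : R -> R) (delta l a K : R) : 0 < l -> l < 2 * delta ->
  measurable_fun setT D -> (forall u, `|D u| <= 1) ->
  {ae mu, forall s, (\int[mu]_u (D u * expR (- delta * (s ^+ 2 + u ^+ 2) + l * (s * u)))%:E = 0)%E} ->
  exists p, [/\ K < p, 0 < p & (\int[mu]_u (D u * normal_pdf a (prec_sd p) u)%:E = 0)%E].
Proof.
move=> l0 ld mD D1 ae0.
have d0 : 0 < delta by lra.
(* Each narrowing adds half of the current rate, hence the ratio 3 / 2; the rates grow beyond every
   bound since j <= 2 (3 / 2) ^ j. *)
pose r j : R := delta * (3 / 2) ^+ j.
have r0 j : 0 < r j by rewrite mulr_gt0// exprn_gt0// divr_gt0.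
have mf j : measurable_fun setT (fun u : R => D u * expR (- r j * u ^+ 2)).
  by apply: measurable_funM => //; apply: measurableT_comp => //; apply: measurable_funM => //; exact: measurable_funX.
have fC j u : `|D u * expR (- r j * u ^+ 2)| <= 1 * expR (- r j * u ^+ 2).
  by rewrite normrM [`|expR _|]ger0_norm ?expR_ge0// ler_wpM2r ?expR_ge0.
have mom j : (forall n, \int[mu]_u (D u * expR (- r j * u ^+ 2) * u ^+ n)%:E = 0)%E.
  elim: j => [|j IH] n.
    by rewrite /r expr0 mulr1; exact: (moments_eq0_of_kernel l0 ld mD D1 ae0).
  rewrite -[RHS](moments_eq0_narrow (r0 j) (mf j) (fC j) IH n).
  apply: eq_integral => u _; congr (EFin (_ * _)); rewrite -mulrA -expRD.
  by congr (_ * expR _); rewrite /r exprS; field.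
have [j Kj] : exists j, K < 2 * r j.
  have [j jK] : exists j, K / delta < j%:R.
    by exists (Num.bound `|K / delta|); apply: le_lt_trans (ler_norm _) (archi_boundP (normr_ge0 _)).
  exists j; rewrite /r; apply: (@lt_le_trans _ _ (delta * j%:R)).
    by rewrite mulrC -ltr_pdivrMr.
  rewrite mulrCA ler_wpM2l ?(ltW d0)//.
  elim: j {jK} => [|j IH]; first by rewrite expr0 mulr1.
  have : 1 <= (3 / 2 : R) ^+ j by rewrite exprn_ege1//; lra.
  by rewrite exprS -(natr1 j); move: IH; move: (j%:R : R) ((3 / 2) ^+ j : R) => v w; lra.
exists (2 * r j); split => //; first by rewrite mulr_gt0.
have p0 : 0 < 2 * r j by rewrite mulr_gt0.
(* Expanding - r j (u - a) ^+ 2 leaves this constant, the centred weight, and a tilt by 2 r j a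
   u. *)
pose c := normal_peak (prec_sd (2 * r j)) * expR (- r j * a ^+ 2).
have h := moments_eq0_tilt (2 * r j * a) (r0 j) (mf j) (fC j) (mom j).
transitivity (\int[mu]_u (c%:E * (D u * expR (- r j * u ^+ 2) * expR (2 * r j * a * u))%:E))%E.
  apply: eq_integral => u _; rewrite -EFinM normal_pdf_prec// /c.
  congr EFin; rewrite (_ : - (2 * r j / 2) * (u - a) ^+ 2 =
    - r j * a ^+ 2 + (- r j * u ^+ 2 + 2 * r j * a * u)); last by field.
  by rewrite !expRD; ring.
rewrite integralZl ?h ?mule0//.
have d20 : 0 < r j / 2 by rewrite divr_gt0.
have [C' C'0 H] := pow_exp_gauss_bounded `|2 * r j * a| 0 (r0 j).
apply: (@integrable_gauss_bounded _ C' _ d20) => [|u].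
  by apply: measurable_funM => //; apply: measurableT_comp => //; exact: measurable_funM.
apply: le_trans (H u); rewrite expr0 mul1r normrM [X in _ * X <= _]ger0_norm ?expR_ge0// mulrC.
rewrite ler_pM ?expR_ge0//; last by rewrite -[leRHS]mul1r.
by rewrite ler_expR -normrM ler_norm.
Qed.

End GaussianBound.

(** * On-path beliefs of the voter *)

Lemma ge0_integral_eq0 d (T : measurableType d) (R : realType)
    (m : {measure set T -> \bar R}) (f : T -> \bar R) :
  measurable_fun setT f -> (forall x, 0 <= f x)%E -> (\int[m]_x f x = 0)%E ->
  {ae m, forall x, f x = 0%E}.
Proof.
move=> mf f0 If0.
have [_] := ae_eq_integral_abs m measurableT mf.
have : (\int[m]_x `|f x| = 0)%E.
  by rewrite -[RHS]If0; apply: eq_integral => x _; rewrite gee0_abs.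
move=> /(ae_eq_integral_abs m measurableT mf).1 h _.
by apply: filterS h => x; exact.
Qed.

Section LeftInverse.
Context (R : realType).

(** A measurable left inverse decodes platforms into signals, which makes the posterior a kernel in
    the platforms. The range of y is connected, hence an interval and measurable. *)
Lemma increasing_measurable_left_inverse (y : R -> R) :
  {mono y : s t / s <= t} -> continuous y ->
  exists2 z : R -> R, measurable_fun setT z & cancel y z.
Proof.
move=> ymono yc.
have yinj : injective y := inc_inj ymono.
have ylt := leW_mono ymono.
have mrange : measurable (range y).
  apply: is_interval_measurable; apply/connected_intervalP.
  apply: connected_continuous_connected; last exact: continuous_subspaceT.
  exact/connected_intervalP.
(* The default 0 off the range explains the case [a < 0] below: the complement of the range then
   belongs to the preimage of the ray above a. *)
pose z x := if pselect (exists s, y s = x) is left e then projT1 (cid e) else 0.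
have yK : cancel y z.
  move=> s; rewrite /z; case: pselect => [e|[]]; last by exists s.
  by case: cid => t /= /yinj.
exists z => //.
apply: (measurability _ (RGenOInfty.measurableE R)) => _ [_ [a ->] <-].
rewrite setTI (_ : z @^-1` _ = (range y `&` `]y a, +oo[) `|`
    (if a < 0 then ~` range y else set0)).
  apply: measurableU; first exact: measurableI.
  by case: ifP => // _; exact: measurableC.
apply/seteqP; split => x /=; rewrite !in_itv/= !andbT.
  have [[s _ <-]|nx] := pselect (range y x).
    by rewrite yK => sa; left; split; [exists s|rewrite ylt].
  rewrite {1}/z; case: pselect => [[s ys]|_ a0]; first by case: nx; exists s.
  by right; rewrite a0.
move=> [[[s _ <-]]|].
  by rewrite yK ylt.
case: ifP => // a0 nx; rewrite /z; case: pselect => [[s ys]|//].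
by case: nx; exists s.
Qed.

Lemma continuous_inj_mono (y : R -> R) : injective y -> continuous y ->
  {mono y : s t / s <= t} \/ {mono y : s t /~ s <= t}.
Proof.
move=> yinj yc.
have [||h|h] := @itv_continuous_inj_mono R y `]-oo, +oo[.
- exact: continuous_subspaceT.
- by move=> s t _ _; exact: yinj.
- by left; apply: le_mono => s t; apply: h.
- by right; apply: le_nmono => s t; apply: h.
Qed.

Lemma continuous_inj_measurable_left_inverse (y : R -> R) :
  injective y -> continuous y ->
  exists2 z : R -> R, measurable_fun setT z & cancel y z.
Proof.
move=> yinj yc; have [ymono|ymono] := continuous_inj_mono yinj yc.
  exact: increasing_measurable_left_inverse.
have [||z mz yK] := @increasing_measurable_left_inverse (fun s => - y s).
- by move=> s t; rewrite lerN2 ymono.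
- by move=> s; apply: cvgN; exact: yc.
- exists (fun x => z (- x)) => //; apply: measurableT_comp => //.
Qed.

End LeftInverse.

Section PosteriorKernel.
Context (R : realType) (alpha beta : R).
Local Notation tau := (alpha + 2 * beta).

(** The normal posterior given both signals, with the signals recovered from the platforms by z. The
    hypotheses are arguments because the kernel structure depends on them. *)
Definition post_kernel (z : R -> R) of 0 < alpha & 0 < beta & measurable_fun setT z :
    R * R -> {measure set measurableTypeR R -> \bar R} :=
  fun p => normal_prob (post_mean2 alpha beta (z p.1) (z p.2)) (prec_sd tau).

Variables (z : R -> R) (alpha_gt0 : 0 < alpha) (beta_gt0 : 0 < beta).
Hypothesis mz : measurable_fun setT z.
Local Notation K := (post_kernel alpha_gt0 beta_gt0 mz).

Let measurable_post_kernel U : measurable U -> measurable_fun [set: R * R] (K ^~ U).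
Proof.
move=> mU; apply: measurable_normal_prob => //.
  by apply: prec_sd_neq0; exact: tau_gt0.
apply: measurable_funM => //; apply: measurable_funM => //.
apply: measurable_funD; apply: measurableT_comp => //.
Qed.

HB.instance Definition _ := isKernel.Build _ _ _ _ _ K measurable_post_kernel.

Let post_kernel_prob p : K p [set: _] = 1%E.
Proof. exact: probability_setT. Qed.

HB.instance Definition _ := Kernel_isProbability.Build _ _ _ _ _ K post_kernel_prob.

End PosteriorKernel.

Section ConditionalLaw.
Context (R : realType) (alpha beta : R) (alpha_gt0 : 0 < alpha) (beta_gt0 : 0 < beta).
Local Notation mu := (@lebesgue_measure R).
Local Notation tau := (alpha + 2 * beta).
Context d (Omega : measurableType d) (P : probability Omega R).
Variables (theta sA sB : {RV P >-> R}).
Hypothesis model : normal_model alpha beta theta sA sB.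

(** The joint signal density is positive everywhere, so P-null sets of signal pairs are
    Lebesgue-null. The conclusion is iterated because later one signal is fixed and the other
    varies. *)
Lemma negligible_signals (M : set (R * R)) : measurable M ->
  P [set o | M (sA o, sB o)] = 0%E ->
  {ae mu, forall s, {ae mu, forall u, ~ M (s, u)}}.
Proof.
move=> mM PM.
have mi : measurable_fun setT (fun p : R * R => (\1_M p)%:E : \bar R).
  by apply/measurable_EFinP; exact: measurable_indic.
have mX : measurable_fun setT (fun o => (sA o, sB o)).
  exact: measurable_fun_pair.
have := integral_law_signals alpha_gt0 beta_gt0 model mi.
rewrite (_ : (\int[P]_o _)%E = 0%E); last first.
  rewrite -[RHS]PM -[X in _ = P X]setTI -(setIT (setT `&` _)) -integral_indic//; last first.
    by apply: mX.
  by apply: eq_integral => o _; rewrite !indicE; congr (nat_of_bool _)%:R%:E; apply/idP/idP; rewrite !inE => // -[].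
move=> /(_ _)/esym E.
pose h (p : measurableTypeR R * measurableTypeR R) : \bar R := ((\1_M p)%:E * (signal_pdf alpha beta p.1 p.2)%:E)%E.
have mh : measurable_fun setT h.
  by apply: emeasurable_funM => //; apply/measurable_EFinP; exact: measurable_signal_pdf.
have h0 p : (0 <= h p)%E.
  by rewrite mule_ge0// lee_fin ?indicE// ltW// signal_pdf_gt0.
have Ih : (\int[mu]_s fubini_F mu h s = 0)%E.
  by apply: E => p; rewrite lee_fin indicE.
have F0 s : (0 <= fubini_F mu h s)%E by apply: integral_ge0.
have ae1 := ge0_integral_eq0 (measurable_fun_fubini_tonelli_F h mh h0) F0 Ih.
apply: (@filterS _ _ (ae_filter_ringOfSetsType mu) _ _ _ ae1) => s Is.
have ae2 := ge0_integral_eq0 (measurable_fun_pair2 s mh) (fun u => h0 (s, u)) Is.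
apply: (@filterS _ _ (ae_filter_ringOfSetsType mu) _ _ _ ae2) => u /=.
rewrite /h /= indicE => /eqP; rewrite mule_eq0 => /orP[] /eqP[] e Mu; move: e.
  by rewrite mem_set// => /eqP; rewrite oner_eq0.
by apply/eqP; rewrite gt_eqF// signal_pdf_gt0.
Qed.

Lemma post_kernel_conditional_law (y z : R -> R) (mz : measurable_fun setT z) :
  measurable_fun setT y -> cancel y z ->
  conditional_law theta sA sB y y (post_kernel alpha_gt0 beta_gt0 mz).
Proof.
move=> my yK C T mC mT.
have mpair : measurable_fun setT (fun p : R * R => (y p.1, y p.2)).
  by apply: measurable_fun_pair; apply: measurableT_comp.
pose F (p : R * R * R) : \bar R := (\1_C (y p.1.1, y p.1.2) * \1_T p.2)%:E.
have mF : measurable_fun setT F.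
  apply/measurable_EFinP/measurable_funM.
    apply: (measurableT_comp (measurable_indic mC)).
    by apply: (measurableT_comp mpair); exact: measurable_fst.
  by apply: (measurableT_comp (measurable_indic mT)); exact: measurable_snd.
pose G (p : R * R) : \bar R := ((\1_C (y p.1, y p.2))%:E *
   normal_prob (post_mean2 alpha beta p.1 p.2) (prec_sd tau) T)%E.
have tau0 : prec_sd tau != 0 by apply: prec_sd_neq0; exact: tau_gt0.
have mG : measurable_fun setT G.
  apply: emeasurable_funM.
    apply/measurable_EFinP; apply: (measurableT_comp (measurable_indic mC)).
    exact: mpair.
  apply: measurable_normal_prob => //.
  apply: measurable_funM => //; apply: measurable_funM => //.
  exact: measurable_funD.
have mplat : measurable (platforms sA sB y y @^-1` C).
  rewrite -[X in measurable X]setTI.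
  have : measurable_fun setT (platforms sA sB y y).
    by apply: measurable_fun_pair; apply: measurableT_comp.
  by apply.
have mth : measurable (theta @^-1` T).
  by rewrite -[X in measurable X]setTI; apply: measurable_funPT.
transitivity (\int[P]_o F (sA o, sB o, theta o))%E.
  rewrite -[X in P X]setIT -integral_indic//; last exact: measurableI.
  by apply: eq_integral => o _; rewrite indicI /F /= !indicE.
transitivity (\int[P]_o G (sA o, sB o))%E; last first.
  rewrite [RHS]integral_mkcond; apply: eq_integral => o _.
  rewrite patchE /G /= indicE /post_kernel /platforms /= !yK.
  rewrite (_ : ((y (sA o), y (sB o)) \in C) = (o \in platforms sA sB y y @^-1` C)); last first.
    by apply/idP/idP; rewrite !inE.
  by case: ifP => _; rewrite ?mul1e ?mul0e.
rewrite (integral_law_post alpha_gt0 beta_gt0 model mF); last first.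
  by move=> p; rewrite lee_fin mulr_ge0// indicE.
rewrite (integral_law_signals alpha_gt0 beta_gt0 model mG); last first.
  by move=> p; rewrite mule_ge0// lee_fin indicE.
apply: eq_integral => s _; apply: eq_integral => u _.
rewrite muleC; congr (_ * _)%E; rewrite /F /G /=.
under eq_integral do rewrite EFinM.
rewrite ge0_integralZl//.
- by rewrite integral_indic// setIT.
- by apply/measurable_EFinP; exact: measurable_indic.
Qed.

End ConditionalLaw.

(** * Probability measures determined by countably many sets *)

Section ProbabilityOfRays.
Context (R : realType).
Local Notation RT := (measurableTypeR R).

Let G : set (set R) := [set A | exists q : rat, A = `]-oo, ratr q]%classic].

Let GE : @measurable _ RT = G.-sigma.-measurable.
Proof.
rewrite [LHS]RGenInftyO.measurableE; apply/seteqP; split.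
  apply: smallest_sub; first exact: smallest_sigma_algebra.
  move=> _ [x ->].
  rewrite (_ : `]-oo, x[%classic = \bigcup_(q : rat)
     (if (ratr q : R) < x then `]-oo, ratr q]%classic else set0)).
    apply: bigcupT_measurable_rat => q; case: ifP => // _.
    by apply: sub_sigma_algebra; exists q.
  apply/seteqP; split => t /=; rewrite in_itv/=.
    move=> tx; have [q] := rat_in_itvoo tx; rewrite in_itv/= => /andP[tq qx].
    by exists q => //; rewrite qx/= in_itv/= ltW.
  by move=> [q _]; case: ifPn => //= qx; rewrite in_itv/= => tq; exact: le_lt_trans qx.
apply: smallest_sub; first exact: smallest_sigma_algebra.
move=> _ [q ->]; rewrite -RGenInftyO.measurableE; exact: measurable_itv.
Qed.

(** Countability of the test sets is the point: it lets an exceptional null set depending on the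
    test set be replaced by a single one. *)
Lemma probability_unique_rat (m1 m2 : {measure set RT -> \bar R}) :
  m1 setT = 1%E -> m2 setT = 1%E ->
  (forall q : rat, m1 `]-oo, ratr q]%classic = m2 `]-oo, ratr q]%classic) ->
  forall A, measurable A -> m1 A = m2 A.
Proof.
move=> m1T m2T m12 A mA.
(* [setT] is adjoined to the rays so that the constant sequence [setT] is an exhausting cover inside
   the generating family. *)
have H := @measure_unique _ R RT (setT |` G) (fun=> setT) _ _ _ _ m1 m2 _ _ A mA.
apply: H => //.
- rewrite GE; apply/seteqP; split; apply: smallest_sub; try exact: smallest_sigma_algebra.
    by move=> B GB; apply: sub_sigma_algebra; right.
  move=> B [->|GB]; last exact: sub_sigma_algebra.
  exact: measurableT.
- move=> B C [->|[q ->]] [->|[r ->]].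
  + by left; rewrite setIT.
  + by right; exists r; rewrite setTI.
  + by right; exists q; rewrite setIT.
  + right; exists (Num.min q r).
    apply/seteqP; split => t /=; rewrite !in_itv/=.
      by move=> [? ?]; rewrite /Order.min; case: ifP.
    rewrite /Order.min; case: ifPn => [qr tq|].
      by split => //; apply: le_trans tq _; rewrite ler_rat ltW.
    by rewrite -leNgt => rq tr; split => //; apply: le_trans tr _; rewrite ler_rat.
- by left.
- by apply/seteqP; split => // x _; exists 0%N.
- by move=> B [->|[q ->]] //; rewrite m1T m2T.
- by rewrite m1T ltry.
Qed.

End ProbabilityOfRays.

Section OnPath.
Context (R : realType) (alpha beta : R) (alpha_gt0 : 0 < alpha) (beta_gt0 : 0 < beta).
Local Notation mu := (@lebesgue_measure R).
Local Notation tau := (alpha + 2 * beta).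
Context d (Omega : measurableType d) (P : probability Omega R).
Variables (theta sA sB : {RV P >-> R}).
Hypothesis model : normal_model alpha beta theta sA sB.
Variable y : R -> R.
Hypothesis my : measurable_fun setT y.
Local Notation plat := (platforms sA sB y y).

Let mplat : measurable_fun setT plat.
Proof. by apply: measurable_fun_pair; apply: measurableT_comp. Qed.

Let law : {measure set (R * R) -> \bar R} :=
  measure_function_pushforward__canonical__measure_function_Measure P mplat.

Lemma conditional_law_unique (k k' : R.-pker (R * R) ~> measurableTypeR R) :
  conditional_law theta sA sB y y k -> conditional_law theta sA sB y y k' ->
  {ae law, forall p, forall T, measurable T -> k p T = k' p T}.
Proof.
move=> kl k'l.
have kfin (h : R.-pker (R * R) ~> measurableTypeR R) T : measurable T ->
    law.-integrable setT (h ^~ T).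
  move=> mT; apply/integrableP; split; first exact: measurable_kernel.
  apply: (@le_lt_trans _ _ (\int[law]_p 1)%E).
    apply: ge0_le_integral => //.
    - by apply: measurableT_comp => //; exact: measurable_kernel.
    - move=> p _; rewrite gee0_abs//.
      have <- : h p setT = 1%E by exact: prob_kernel.
      by rewrite le_measure// inE.
  rewrite integral_cst// mul1e /= /pushforward preimage_setT probability_setT.
  exact: ltry.
have aeT T : measurable T -> {ae law, forall p, k p T = k' p T}.
  move=> mT; have := @integral_ae_eq _ _ _ law setT measurableT (k' ^~ T) (k ^~ T)
    (kfin k T mT) (measurable_kernel k' T mT).
  have H : forall C, C `<=` setT -> measurable C ->
      (\int[law]_(p in C) k p T = \int[law]_(p in C) k' p T)%E.
    move=> C _ mC; rewrite !ge0_integral_pushforward//.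
    - by rewrite -kl// -k'l.
    - by apply: measurable_funTS; exact: measurable_kernel.
    - by apply: measurable_funTS; exact: measurable_kernel.
  by move=> /(_ H); apply: filterS => p; exact.
(* The null set obtained so far depends on T. Enumerating the rationals with [unpickle] collects
   countably many of them, one for each rational ray. *)
have aen : {ae law, forall p, forall n, if unpickle n is Some q then
    k p `]-oo, ratr (q : rat)]%classic = k' p `]-oo, ratr q]%classic else True}.
  apply: ae_foralln => n; case: unpickle => [q|]; last exact: aeW.
  exact: aeT.
apply: filterS aen => p kp T mT; apply: probability_unique_rat => //.
- exact: prob_kernel.
- exact: prob_kernel.
- by move=> q; have := kp (pickle q); rewrite pickleK.
Qed.

Lemma voter_eu_normal (nu : probability (measurableTypeR R) R) (m x : R) :
  (forall T, measurable T -> nu T = normal_prob m (prec_sd tau) T) ->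
  voter_eu nu x = (- ((x - m) ^+ 2 + prec_sd tau ^+ 2))%:E.
Proof.
move=> nuE; rewrite /voter_eu.
rewrite (@eq_measure_integral _ _ _ _ (normal_prob m (prec_sd tau))); last first.
  by move=> T mT _; exact: nuE.
under eq_integral do rewrite EFinN.
rewrite integral_ge0N; last by move=> t _; rewrite lee_fin sqr_ge0.
by rewrite integral_normal_prob_sqrB ?prec_sd_neq0 ?tau_gt0.
Qed.

(** Two sets of platform pairs are discarded: where the belief differs from its conditional law, and
    where that law differs from [post_kernel]. Pulled back to signals both are negligible. Elsewhere
    the posterior variance cancels from the voter's comparison, leaving squared distances to the
    posterior mean. *)
Lemma voter_on_path (w : R * R -> R) (nu : belief R) :
  injective y -> continuous y ->
  bayes_on_path theta sA sB y y nu -> voter_optimal nu w ->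
  {ae mu, forall s, {ae mu, forall u, let m := post_mean2 alpha beta s u in
    ((y s - m) ^+ 2 < (y u - m) ^+ 2 -> w (y s, y u) = 1) /\
    ((y u - m) ^+ 2 < (y s - m) ^+ 2 -> w (y s, y u) = 0)}}.
Proof.
move=> yinj yc [k kl nuk] wopt.
have [z mz yK] := continuous_inj_measurable_left_inverse yinj yc.
have k'l := post_kernel_conditional_law alpha_gt0 beta_gt0 model mz my yK.
have [N [mN N0 subN]] := conditional_law_unique kl k'l.
have [N' [mN' N'0 subN']] := nuk.
have mpair : measurable_fun setT (fun p : R * R => (y p.1, y p.2)).
  by apply: measurable_fun_pair; apply: measurableT_comp.
pose M : set (R * R) := (fun p : R * R => (y p.1, y p.2)) @^-1` (N `|` N').
have mM : measurable M.
  by rewrite -[X in measurable X]setTI; apply: mpair => //; exact: measurableU.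
have PM : P [set o | M (sA o, sB o)] = 0%E.
  have -> : [set o | M (sA o, sB o)] = plat @^-1` (N `|` N') by [].
  apply/eqP; rewrite -measure_le0 preimage_setU.
  apply: le_trans (measureU2 _ _ _) _.
  - by rewrite -[X in measurable X]setTI; exact: mplat.
  - by rewrite -[X in measurable X]setTI; exact: mplat.
  - by rewrite -[X in (X + _ <= _)%E]/(law N) N0 add0e
      -[X in (X <= _)%E]/(pushforward P plat N') N'0.
have := negligible_signals alpha_gt0 beta_gt0 model mM PM.
move=> ae0; apply: (@filterS _ _ (ae_filter_ringOfSetsType mu) _ _ _ ae0) => s aes.
apply: (@filterS _ _ (ae_filter_ringOfSetsType mu) (fun u => ~ M (s, u)) _ _ aes).
move=> u nM; cbv zeta; set m := post_mean2 _ _ _ _.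
have /not_orP[nN nN'] := nM.
have e1 : forall T, measurable T -> k (y s, y u) T = post_kernel alpha_gt0 beta_gt0 mz (y s, y u) T.
  by apply: contrapT => h; apply: nN; exact: subN.
have e2 : forall T, measurable T -> nu (y s, y u) T = k (y s, y u) T.
  by apply: contrapT => h; apply: nN'; exact: subN'.
have E T : measurable T -> nu (y s, y u) T = normal_prob m (prec_sd tau) T.
  by move=> mT; rewrite e2// e1// /post_kernel /= !yK.
have [w1 w0] := wopt (y s) (y u).
by split => h; [apply: w1|apply: w0];
  rewrite !(voter_eu_normal _ E) lte_fin ltrN2 ltrD2r.
Qed.

End OnPath.

(** * Imitation in the zero-sum game *)

Section AlmostEverywhere.
Context (R : realType).
Local Notation mu := (@lebesgue_measure R).

Lemma ae_exists_in_itv (Q : R -> Prop) (a b : R) : a < b ->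
  {ae mu, forall s, Q s} -> exists2 s, a < s < b & Q s.
Proof.
move=> ab [N [mN N0 subN]]; apply: contrapT => nQ.
have : (mu `]a, b[%classic <= mu N)%E.
  apply: le_measure; rewrite ?inE//.
  move=> s /=; rewrite in_itv/= => asb; apply: subN => Qs.
  by apply: nQ; exists s.
rewrite N0 lebesgue_measure_itv/= lte_fin ab -EFinD lee_fin => h.
by move: ab; rewrite -subr_gt0 ltNge h.
Qed.

(** The difference of g and f is nonnegative a.e. and has zero integral; finiteness of the integral
    of g makes the subtraction legitimate. *)
Lemma ae_eq_of_le_integral d (T : measurableType d) (m : {measure set T -> \bar R})
    (f g : T -> \bar R) :
  measurable_fun setT f -> measurable_fun setT g ->
  (forall x, 0 <= f x)%E -> (forall x, 0 <= g x)%E ->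
  {ae m, forall x, (f x <= g x)%E} -> (\int[m]_x g x < +oo)%E ->
  (\int[m]_x g x <= \int[m]_x f x)%E -> {ae m, forall x, f x = g x}.
Proof.
move=> mf mg f0 g0 fg goo gf.
have fg' : (\int[m]_x f x <= \int[m]_x g x)%E.
  by apply: ae_ge0_le_integral => //; apply: filterS fg => x.
have ig : m.-integrable setT g.
  apply/integrableP; split => //.
  by under eq_integral do rewrite gee0_abs//.
have jf : m.-integrable setT f.
  apply/integrableP; split => //.
  under eq_integral do rewrite gee0_abs//.
  exact: le_lt_trans goo.
have mgf : measurable_fun setT (g \- f)%E by exact: emeasurable_funB.
have aef := integrable_ae measurableT jf.
have aeg := integrable_ae measurableT ig.
have I0 : (\int[m]_x `|(g \- f) x| = 0)%E.
  transitivity (\int[m]_x (g \- f) x)%E.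
    apply: ae_eq_integral => //; first exact: measurableT_comp.
    near=> x => _; have fx : f x \is a fin_num.
      by near: x; apply: filterS aef => x h; exact: h.
    by rewrite gee0_abs// sube_ge0 ?fx ?orbT//; near: x.
  rewrite integralB//.
  have -> : (\int[m]_x f x = \int[m]_x g x)%E.
    by apply/eqP; rewrite eq_le fg' gf.
  by rewrite subee// ge0_fin_numE//; exact: integral_ge0.
have mabs : measurable_fun setT (fun x => `|(g \- f) x|)%E by exact: measurableT_comp.
have h := ge0_integral_eq0 mabs (fun x => abse_ge0 _) I0.
near=> x.
have : ((g \- f) x = 0)%E.
  by apply/eqP; rewrite -abse_eq0; apply/eqP; near: x.
have fx : f x \is a fin_num by near: x; apply: filterS aef => x h'; exact: h'.
move=> e; have e' : (g x - f x = 0)%E by exact: e.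
by have := subeK (g x) fx; rewrite e' add0e.
Unshelve. all: end_near.
Qed.

End AlmostEverywhere.

(** * Null sets of signals and the minimax argument *)

Section SignalNull.
Context (R : realType) (alpha beta : R) (alpha_gt0 : 0 < alpha) (beta_gt0 : 0 < beta).
Local Notation mu := (@lebesgue_measure R).
Context d (Omega : measurableType d) (P : probability Omega R).
Variables (theta sA sB : {RV P >-> R}).
Hypothesis model : normal_model alpha beta theta sA sB.

Lemma ae_signalA (Q : R -> Prop) :
  {ae distribution P sA, forall s, Q s} -> {ae mu, forall s, Q s}.
Proof.
move=> [N [mN N0 subN]].
have mM : measurable [set p : R * R | N p.1].
  by rewrite -[X in measurable X]setTI; exact: measurable_fst.
have := negligible_signals alpha_gt0 beta_gt0 model mM N0.
move=> ae0; apply: (@filterS _ _ (ae_filter_ringOfSetsType mu) _ _ _ ae0) => s aes.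
have [_ _ /= nN] := ae_exists_in_itv ltr01 aes.
by apply: contrapT => nQ; apply: nN; exact: subN.
Qed.

Lemma ae_signalB (Q : R -> Prop) :
  {ae distribution P sB, forall s, Q s} -> {ae mu, forall s, Q s}.
Proof.
move=> [N [mN N0 subN]].
have mM : measurable [set p : R * R | N p.2].
  by rewrite -[X in measurable X]setTI; exact: measurable_snd.
have := negligible_signals alpha_gt0 beta_gt0 model mM N0.
move=> /(ae_exists_in_itv ltr01)[s _] /= aes.
apply: (@filterS _ _ (ae_filter_ringOfSetsType mu) _ _ _ aes) => u nN.
by apply: contrapT => nQ; apply: nN; exact: subN.
Qed.

Local Notation q s u := ((signal_pdf alpha beta s u)%:E).

Lemma integral_signal_pdf_fin s : exists2 c : R, 0 < c & (\int[mu]_u q s u = c%:E)%E.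
Proof.
have m1 : measurable_fun setT (cst 1 : R -> R) by [].
have := integral_signal_pdf alpha_gt0 beta_gt0 s m1.
set c := _ * _ => E.
have {}E : (\int[mu]_u q s u = c%:E)%E.
  rewrite -E; last by move=> u; rewrite ler01 lexx.
  by apply: eq_integral => u _; rewrite mul1r.
exists c => //.
have c0 : 0 <= c.
  by rewrite -lee_fin -E; apply: integral_ge0 => u _; rewrite lee_fin ltW// signal_pdf_gt0.
rewrite lt_neqAle c0 andbT eq_sym; apply/eqP => c00.
have mq : measurable_fun setT (fun u => q s u).
  by apply/measurable_EFinP; exact: measurable_signal_pdf.
have q0 u : (0 <= q s u)%E by rewrite lee_fin ltW// signal_pdf_gt0.
have := @ge0_integral_eq0 _ _ _ mu _ mq q0; rewrite E c00 => /(_ erefl) ae0.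
have [u _ [] /eqP] := ae_exists_in_itv ltr01 ae0.
by rewrite gt_eqF// signal_pdf_gt0.
Qed.

Lemma integral_signal_pdf2 : (\int[mu]_s \int[mu]_u q s u = 1)%E.
Proof.
have m1 : measurable_fun setT (cst 1%E : R * R -> \bar R) by [].
have := integral_law_signals alpha_gt0 beta_gt0 model m1 (fun=> lee01).
rewrite integral_cst//= [X in (_ * X)%E]probability_setT mule1 => ->.
by apply: eq_integral => s _; apply: eq_integral => u _; rewrite mul1e.
Qed.

(* In the zero-sum game each player can ignore the signal and imitate any
   type s'; integrating both players' optimality against the product of the
   marginals shows that a.e. such imitation is itself optimal. *)
Lemma imitation_optimal (phi : R * R -> R) :
  measurable_fun setT phi -> (forall p, 0 <= phi p <= 1) ->
  {ae mu, forall s, forall s', (\int[mu]_u ((phi (s', u))%:E * q s u) <=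
     \int[mu]_u ((phi (s, u))%:E * q s u))%E} ->
  {ae mu, forall s, forall s', (\int[mu]_u ((1 - phi (u, s'))%:E * q s u) <=
     \int[mu]_u ((1 - phi (u, s))%:E * q s u))%E} ->
  {ae mu, forall s', {ae mu, forall s, (\int[mu]_u ((phi (s', u))%:E * q s u) =
     \int[mu]_u ((phi (s, u))%:E * q s u))%E}}.
Proof.
move=> mphi phi01 hA hB.
have mphiE : measurable_fun setT (EFin \o phi) by exact/measurable_EFinP.
pose F (u : R) : \bar R := (\int[mu]_s q u s)%E.
have q0 s u : (0 <= q s u)%E by rewrite lee_fin ltW// signal_pdf_gt0.
have p0 p : (0 <= (phi p)%:E)%E by rewrite lee_fin; case/andP: (phi01 p).
have p10 p : (0 <= (1 - phi p)%:E)%E by rewrite lee_fin subr_ge0; case/andP: (phi01 p).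
have mq d' (T : measurableType d') (g h : T -> R) :
    measurable_fun setT g -> measurable_fun setT h ->
    measurable_fun setT (fun x => q (g x) (h x)).
  by move=> mg mh; apply/measurable_EFinP; exact: measurable_signal_pdf.
have mp d' (T : measurableType d') (g h : T -> R) :
    measurable_fun setT g -> measurable_fun setT h ->
    measurable_fun setT (fun x => (phi (g x, h x))%:E).
  by move=> mg mh; apply: (measurableT_comp mphiE); exact: measurable_fun_pair.
have mp1 d' (T : measurableType d') (g h : T -> R) :
    measurable_fun setT g -> measurable_fun setT h ->
    measurable_fun setT (fun x => (1 - phi (g x, h x))%:E).
  move=> mg mh; apply/measurable_EFinP/measurable_funB => //.
  by apply: (measurableT_comp mphi); exact: measurable_fun_pair.
pose RT := measurableTypeR R.
have m1 : measurable_fun setT (fst : RT * RT -> R) by exact: measurable_fst.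
have m2 : measurable_fun setT (snd : RT * RT -> R) by exact: measurable_snd.
have mF : measurable_fun setT F.
  apply: (measurable_fun_fubini_tonelli_F (fun p : RT * RT => q p.1 p.2)) => //.
  exact: mq.
have F0 u : (0 <= F u)%E by apply: integral_ge0.
have swap (h : RT * RT -> \bar R) : measurable_fun setT h -> (forall p, 0 <= h p)%E ->
    (\int[mu]_s \int[mu]_u h (s, u) = \int[mu]_u \int[mu]_s h (s, u))%E.
  by move=> mh h0; exact: (@fubini_tonelli _ _ _ _ R mu mu h mh h0).
have mint (h : RT * RT -> \bar R) : measurable_fun setT h -> (forall p, 0 <= h p)%E ->
    measurable_fun setT (fun s => \int[mu]_u h (s, u))%E.
  by move=> mh h0; exact: (measurable_fun_fubini_tonelli_F h mh h0).
(* [V] and [W] are the equilibrium payoffs of A and B. Below, [A s'] and [B s'] are the ex-ante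
   payoffs of always imitating s' while the opponent plays the equilibrium strategy. *)
pose V := (\int[mu]_s \int[mu]_u ((phi (s, u))%:E * q s u))%E.
pose W := (\int[mu]_s \int[mu]_u ((1 - phi (s, u))%:E * q s u))%E.
pose A s' := (\int[mu]_u ((phi (s', u))%:E * F u))%E.
pose B s' := (\int[mu]_u ((1 - phi (u, s'))%:E * F u))%E.
have VW : (V + W = 1)%E.
  rewrite -integral_signal_pdf2 -ge0_integralD//.
  - apply: eq_integral => s _; rewrite -ge0_integralD//.
    + by apply: eq_integral => u _; rewrite -EFinM -EFinM -EFinD -mulrDl addrC subrK mul1r.
    + by move=> u _; rewrite mule_ge0.
    + by apply: emeasurable_funM; [exact: mp|exact: mq].
    + by move=> u _; rewrite mule_ge0.
    + by apply: emeasurable_funM; [exact: mp1|exact: mq].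
  - by move=> s _; apply: integral_ge0 => u _; rewrite mule_ge0.
  - apply: (mint (fun p => (phi (p.1, p.2))%:E * q p.1 p.2)%E).
      by apply: emeasurable_funM; [exact: mp|exact: mq].
    by move=> p; rewrite mule_ge0.
  - by move=> s _; apply: integral_ge0 => u _; rewrite mule_ge0.
  - apply: (mint (fun p => (1 - phi (p.1, p.2))%:E * q p.1 p.2)%E).
      by apply: emeasurable_funM; [exact: mp1|exact: mq].
    by move=> p; rewrite mule_ge0.
have V0 : (0 <= V)%E.
  by apply: integral_ge0 => s _; apply: integral_ge0 => u _; rewrite mule_ge0.
have W0 : (0 <= W)%E.
  by apply: integral_ge0 => s _; apply: integral_ge0 => u _; rewrite mule_ge0.
have Vfin : V \is a fin_num.
  by rewrite ge0_fin_numE// (@le_lt_trans _ _ 1%E) ?ltry// -VW leeDl.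
have Wfin : W \is a fin_num.
  by rewrite ge0_fin_numE// (@le_lt_trans _ _ 1%E) ?ltry// -VW leeDr.
have AE s' : A s' = (\int[mu]_s \int[mu]_u ((phi (s', u))%:E * q s u))%E.
  rewrite (swap (fun p => (phi (s', p.2))%:E * q p.1 p.2)%E).
  - apply: eq_integral => u _ /=; rewrite ge0_integralZl//.
    + by congr (_ * _)%E; apply: eq_integral => s _ /=; rewrite signal_pdfC.
    + exact: mq.
  - by apply: emeasurable_funM; [exact: mp|exact: mq].
  - by move=> p; rewrite mule_ge0.
have BE s' : B s' = (\int[mu]_s \int[mu]_u ((1 - phi (u, s'))%:E * q s u))%E.
  rewrite (swap (fun p => (1 - phi (p.2, s'))%:E * q p.1 p.2)%E).
  - apply: eq_integral => u _ /=; rewrite ge0_integralZl//.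
    + by congr (_ * _)%E; apply: eq_integral => s _ /=; rewrite signal_pdfC.
    + exact: mq.
  - by apply: emeasurable_funM; [exact: mp1|exact: mq].
  - by move=> p; rewrite mule_ge0.
have AE' : A = fun s => (\int[mu]_u ((phi (s, u))%:E * F u))%E := erefl.
have BE' : B = fun s => (\int[mu]_u ((1 - phi (u, s))%:E * F u))%E := erefl.
clearbody A B.
have AV s' : (A s' <= V)%E.
  rewrite AE; apply: ae_ge0_le_integral => //.
  - by move=> s _; apply: integral_ge0 => u _; rewrite mule_ge0.
  - apply: (mint (fun p => (phi (s', p.2))%:E * q p.1 p.2)%E).
      by apply: emeasurable_funM; [exact: mp|exact: mq].
    by move=> p; rewrite mule_ge0.
  - by move=> s _; apply: integral_ge0 => u _; rewrite mule_ge0.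
  - apply: (mint (fun p => (phi (p.1, p.2))%:E * q p.1 p.2)%E).
      by apply: emeasurable_funM; [exact: mp|exact: mq].
    by move=> p; rewrite mule_ge0.
  - apply: (@filterS _ _ (ae_filter_ringOfSetsType mu) _ _ _ hA) => s h _; exact: h.
have WE : W = (\int[mu]_s \int[mu]_u ((1 - phi (u, s))%:E * q s u))%E.
  rewrite /W (swap (fun p => (1 - phi (p.1, p.2))%:E * q p.1 p.2)%E).
  - by apply: eq_integral => s _; apply: eq_integral => u _ /=; rewrite signal_pdfC.
  - by apply: emeasurable_funM; [exact: mp1|exact: mq].
  - by move=> p; rewrite mule_ge0.
have VE : (\int[mu]_s \int[mu]_u ((phi (s, u))%:E * q s u))%E = V := erefl.
clearbody V W.
have BW s' : (B s' <= W)%E.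
  rewrite BE [X in (_ <= X)%E]WE; apply: ae_ge0_le_integral => //.
  - by move=> s _; apply: integral_ge0 => u _; rewrite mule_ge0.
  - apply: (mint (fun p => (1 - phi (p.2, s'))%:E * q p.1 p.2)%E).
      by apply: emeasurable_funM; [exact: mp1|exact: mq].
    by move=> p; rewrite mule_ge0.
  - by move=> s _; apply: integral_ge0 => u _; rewrite mule_ge0.
  - apply: (mint (fun p => (1 - phi (p.2, p.1))%:E * q p.1 p.2)%E).
      by apply: emeasurable_funM; [exact: mp1|exact: mq].
    by move=> p; rewrite mule_ge0.
  - apply: (@filterS _ _ (ae_filter_ringOfSetsType mu) _ _ _ hB) => s h _; exact: h.
have IF : (\int[mu]_s F s = 1)%E by exact: integral_signal_pdf2.
have Fc s : exists2 c : R, 0 < c & F s = c%:E by exact: integral_signal_pdf_fin.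
clearbody F.
have mFc d' (T : measurableType d') (g : T -> R) :
    measurable_fun setT g -> measurable_fun setT (fun x => F (g x)).
  by move=> mg; exact: measurableT_comp.
have A0 s' : (0 <= A s')%E by rewrite AE'; apply: integral_ge0 => u _; rewrite mule_ge0.
have B0 s' : (0 <= B s')%E by rewrite BE'; apply: integral_ge0 => u _; rewrite mule_ge0.
have mA : measurable_fun setT A.
  rewrite AE'.
  apply: (mint (fun p => (phi (p.1, p.2))%:E * F p.2)%E).
    by apply: emeasurable_funM; [exact: mp|exact: mFc].
  by move=> p; rewrite mule_ge0.
have mB : measurable_fun setT B.
  rewrite BE'.
  apply: (mint (fun p => (1 - phi (p.2, p.1))%:E * F p.2)%E).
    by apply: emeasurable_funM; [exact: mp1|exact: mFc].
  by move=> p; rewrite mule_ge0.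
(* [X] and [Y] are the payoffs when both candidates imitate independent types of density [F]; like
   [V] and [W] they sum to 1. *)
pose X := (\int[mu]_s (F s * A s))%E.
pose Y := (\int[mu]_s (F s * B s))%E.
have YE : Y = (\int[mu]_s (F s * \int[mu]_u ((1 - phi (s, u))%:E * F u)))%E.
  transitivity (\int[mu]_s \int[mu]_u (F s * ((1 - phi (u, s))%:E * F u)))%E.
    apply: eq_integral => s _; rewrite BE'; apply/esym; apply: ge0_integralZl => //.
    - by apply: emeasurable_funM => //; exact: mp1.
    - by move=> u _; rewrite mule_ge0.
  rewrite (swap (fun p => F p.1 * ((1 - phi (p.2, p.1))%:E * F p.2))%E).
  - apply: eq_integral => s _; rewrite -ge0_integralZl//.
    + by apply: eq_integral => u _ /=; rewrite muleCA [RHS]muleCA [(F u * F s)%E]muleC.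
    + by apply: emeasurable_funM => //; exact: mp1.
    + by move=> u _; rewrite mule_ge0.
  - by apply: emeasurable_funM; [exact: mFc|apply: emeasurable_funM; [exact: mp1|exact: mFc]].
  - by move=> p; rewrite mule_ge0// mule_ge0.
have XY : (X + Y = 1)%E.
  rewrite YE -ge0_integralD//.
  - rewrite -[RHS]IF; apply: eq_integral => s _; rewrite AE'.
    rewrite -ge0_muleDr//; last 2 first.
    + by apply: integral_ge0 => u _; rewrite mule_ge0.
    + by apply: integral_ge0 => u _; rewrite mule_ge0.
    rewrite -ge0_integralD//.
    + rewrite -[RHS]mule1 -IF; congr (_ * _)%E; apply: eq_integral => u _.
      by rewrite -ge0_muleDl// -EFinD addrC subrK mul1e.
    + by move=> u _; rewrite mule_ge0.
    + by apply: emeasurable_funM => //; exact: mp.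
    + by move=> u _; rewrite mule_ge0.
    + by apply: emeasurable_funM => //; exact: mp1.
  - by move=> s _; rewrite mule_ge0.
  - exact: emeasurable_funM.
  - by move=> s _; rewrite mule_ge0//; apply: integral_ge0 => u _; rewrite mule_ge0.
  - apply: emeasurable_funM => //.
    apply: (mint (fun p => (1 - phi (p.1, p.2))%:E * F p.2)%E).
      by apply: emeasurable_funM; [exact: mp1|exact: mFc].
    by move=> p; rewrite mule_ge0.
have FV : (\int[mu]_s (F s * V) = V)%E by rewrite ge0_integralZr// IF mul1e.
have XE : X = (\int[mu]_s (F s * A s))%E := erefl.
clearbody X.
have YW : (Y <= W)%E.
  have <- : (\int[mu]_s (F s * W) = W)%E by rewrite ge0_integralZr// IF mul1e.
  apply: ge0_le_integral => //.
  - by move=> s _; rewrite mule_ge0.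
  - exact: emeasurable_funM.
  - by apply: emeasurable_funM.
  - by move=> s _; rewrite lee_wpmul2l.
(* From V + W = 1 = X + Y and Y <= W. As A s' <= V for every s', equality must hold almost
   everywhere under the average that defines [X]. *)
have VX : (V <= X)%E.
  by rewrite -(leeD2rE _ _ Wfin) VW -XY leeD2l.
have aeA : {ae mu, forall s, (F s * A s = F s * V)%E}.
  apply: ae_eq_of_le_integral => //.
  - exact: emeasurable_funM.
  - exact: emeasurable_funM.
  - by move=> s; rewrite mule_ge0.
  - by move=> s; rewrite mule_ge0.
  - by apply: aeW => s; rewrite lee_wpmul2l.
  - by rewrite FV -ge0_fin_numE.
  - by rewrite FV -XE.
apply: (@filterS _ _ (ae_filter_ringOfSetsType mu) _ _ _ aeA) => s' FA.
have {}FA : A s' = V.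
  have [c c0 Fs] := Fc s'.
  move: FA; rewrite Fs => /(congr1 (fun x => (c^-1)%:E * x)%E).
  by rewrite !muleA -EFinM mulVf ?gt_eqF// !mul1e.
(* For this s' the interim inequalities in s have equal finite integrals, so almost all of them are
   equalities. *)
apply: ae_eq_of_le_integral.
- apply: (mint (fun p => (phi (s', p.2))%:E * q p.1 p.2)%E).
    by apply: emeasurable_funM; [exact: mp|exact: mq].
  by move=> p; rewrite mule_ge0.
- apply: (mint (fun p => (phi (p.1, p.2))%:E * q p.1 p.2)%E).
    by apply: emeasurable_funM; [exact: mp|exact: mq].
  by move=> p; rewrite mule_ge0.
- by move=> s; apply: integral_ge0 => u _; rewrite mule_ge0.
- by move=> s; apply: integral_ge0 => u _; rewrite mule_ge0.
- by apply: (@filterS _ _ (ae_filter_ringOfSetsType mu) _ _ _ hA) => s h; exact: h.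
- by rewrite VE -ge0_fin_numE.
- by rewrite VE -AE FA.
Qed.

End SignalNull.

(** * Uniqueness *)

Lemma continuous_measurable_real (R : realType) (f : R -> R) :
  continuous f -> measurable_fun setT f.
Proof. exact: continuous_measurable_fun. Qed.

Lemma no_constant_sign (R : realType) (D : R -> R) (a r b : R) : 0 < r ->
  measurable_fun setT D -> (forall u, `|D u| <= 1) -> `|b| = 1 ->
  {ae @lebesgue_measure R, forall u, `|u - a| < r -> D u = b} ->
  (forall K, exists p, [/\ K < p, 0 < p &
    (\int[@lebesgue_measure R]_u (D u * normal_pdf a (prec_sd p) u)%:E = 0)%E]) -> False.
Proof.
move=> r0 mD D1 b1 Db H.
have bb : b * b = 1 by rewrite -expr2 -(real_normK (num_real b)) b1 expr1n.
have r20 : 0 < r ^+ 2 by rewrite exprn_gt0.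
(* By Chebyshev a normal law of precision p gives mass at most 1 / (p r ^+ 2) outside the ball.
   There 1 - b D is at most 2 and inside it is 0, so the integral of 1 - b D, which equals 1, would
   be below 1 once p exceeds 2 / r ^+ 2. *)
have [p [Kp p0 ID]] := H (2 / r ^+ 2).
have sp0 := prec_sd_neq0 p0.
pose n u := normal_pdf a (prec_sd p) u.
have n0 u : 0 <= n u by exact: normal_pdf_ge0.
have mn : measurable_fun setT n by exact: measurable_normal_pdf.
have iin : (@lebesgue_measure R).-integrable setT (fun u => (n u)%:E).
  exact: integrable_normal_pdf.
have iD : (@lebesgue_measure R).-integrable setT (fun u => (D u * n u)%:E).
  apply: (le_integrable measurableT _ _ iin).
    by apply/measurable_EFinP/measurable_funM.
  by move=> u _ /=; rewrite lee_fin normrM -[leRHS]mul1r ler_wpM2r.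
have E1 : (\int[@lebesgue_measure R]_u ((1 - b * D u) * n u)%:E = 1)%E.
  transitivity (\int[@lebesgue_measure R]_u ((n u)%:E - b%:E * (D u * n u)%:E))%E.
    by apply: eq_integral => u _; rewrite -EFinM -EFinB; congr EFin; ring.
  rewrite integralB//; last exact: integrableZl.
  by rewrite integralZl// ID mule0 sube0 integral_normal_pdf.
have bD u : b * D u <= 1.
  by apply: le_trans (ler_norm _) _; rewrite normrM b1 mul1r.
have E2 : (\int[@lebesgue_measure R]_u ((1 - b * D u) * n u)%:E <=
    \int[@lebesgue_measure R]_u ((2 / r ^+ 2)%:E * ((u - a) ^+ 2 * n u)%:E))%E.
  apply: ae_ge0_le_integral => //.
  - by move=> u _; rewrite lee_fin mulr_ge0// subr_ge0.
  - by apply/measurable_EFinP/measurable_funM => //; apply: measurable_funB => //; exact: measurable_funM.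
  - by move=> u _; rewrite -EFinM lee_fin mulr_ge0//; [rewrite divr_ge0// ltW|rewrite mulr_ge0// sqr_ge0].
  - apply/measurable_EFinP; apply: measurable_funM => //; apply: measurable_funM => //.
    by apply: measurable_funX; exact: measurable_funB.
  - apply: (@filterS _ _ (ae_filter_ringOfSetsType (@lebesgue_measure R)) _ _ _ Db) => u Du _.
    rewrite -EFinM lee_fin mulrA ler_wpM2r//.
    have [ur|ur] := ltP `|u - a| r.
      by rewrite Du// bb subrr mulr_ge0 ?sqr_ge0// divr_ge0// ltW.
    apply: (@le_trans _ _ 2).
      have : -1 <= b * D u.
        by rewrite lerNl; apply: le_trans (ler_norm _) _; rewrite normrN normrM b1 mul1r.
      by lra.
    rewrite mulrAC ler_pdivlMr// ler_wpM2l// -(real_normK (num_real (u - a))).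
    by rewrite ler_pXn2r// nnegrE ltW.
move: E2; rewrite E1 ge0_integralZl//; last 3 first.
- apply/measurable_EFinP; apply: measurable_funM => //.
  by apply: measurable_funX; exact: measurable_funB.
- by move=> u _; rewrite lee_fin mulr_ge0// sqr_ge0.
- by rewrite lee_fin divr_ge0// ltW.
have -> : (\int[@lebesgue_measure R]_u ((u - a) ^+ 2 * n u)%:E = (p^-1)%:E)%E.
  rewrite -(sqr_prec_sd p0) -(integral_normal_prob_sqr a sp0) ge0_integral_normal_prob//.
  - by apply/measurable_EFinP/measurable_funX/measurable_funB.
  - by move=> u; rewrite lee_fin sqr_ge0.
rewrite -EFinM lee_fin ler_pdivlMr// mul1r => h.
by have := lt_le_trans Kp h; rewrite ltxx.
Qed.

Section Uniqueness.
Context (R : realType) (alpha beta : R) (alpha_gt0 : 0 < alpha) (beta_gt0 : 0 < beta).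
Local Notation mu := (@lebesgue_measure R).
Local Notation tau := (alpha + 2 * beta).
Context d (Omega : measurableType d) (P : probability Omega R).
Variables (theta sA sB : {RV P >-> R}).
Hypothesis model : normal_model alpha beta theta sA sB.
Local Notation q s u := (signal_pdf alpha beta s u).

Lemma equilibrium_platform (y : R -> R) (w : R * R -> R) :
  injective y -> continuous y ->
  equilibrium alpha beta theta sA sB y y w ->
  forall s, y s = 2 * beta / tau * s.
Proof.
move=> yinj yc [[_ _ [mw w01]] [brA brB [nu nuk wopt]]] s0.
have my := continuous_measurable_real yc.
pose phi (p : R * R) := w (y p.1, y p.2).
have mphi : measurable_fun setT phi.
  apply: (measurableT_comp mw); apply: measurable_fun_pair; apply: measurableT_comp => //.
have phi01 p : 0 <= phi p <= 1 by exact: w01.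
have mpR s : measurable_fun setT (fun u => phi (s, u)).
  exact: (measurable_fun_pair2 s mphi).
have mpL s : measurable_fun setT (fun u => phi (u, s)).
  exact: (measurable_fun_pair1 s mphi).
have win (g : R -> R) s : measurable_fun setT g -> (forall u, 0 <= g u <= 1) ->
    (\int[mu]_u ((g u)%:E * (q s u)%:E) = (marginal_pdf alpha beta s * posterior alpha beta [:: s]
      (fun t => \int[normal_prob t (prec_sd beta)]_u g u))%:E)%E.
  by move=> mg g01; rewrite -integral_signal_pdf//.
have winA s s' : (\int[mu]_u ((phi (s', u))%:E * (q s u)%:E) = (marginal_pdf alpha beta s *
    interim_win alpha beta (fun x x' => w (x, x')) y s (y s'))%:E)%E.
  exact: (win (fun u => phi (s', u)) s (mpR s') (fun u => phi01 (s', u))).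
have hA : {ae mu, forall s, forall s', (\int[mu]_u ((phi (s', u))%:E * (q s u)%:E) <=
     \int[mu]_u ((phi (s, u))%:E * (q s u)%:E))%E}.
  have aeA := ae_signalA alpha_gt0 beta_gt0 model brA.
  apply: (@filterS _ _ (ae_filter_ringOfSetsType mu) _ _ _ aeA) => s Hs s'.
  rewrite (winA s s') (winA s s) lee_fin ler_wpM2l//.
  by rewrite ltW//; have [] := integral_prior_pdf alpha_gt0 beta_gt0 s.
have winB s s' : (\int[mu]_u ((1 - phi (u, s'))%:E * (q s u)%:E) = (marginal_pdf alpha beta s *
    interim_win alpha beta (fun x x' => 1 - w (x', x)) y s (y s'))%:E)%E.
  apply: (win (fun u => 1 - phi (u, s')) s); first exact: measurable_funB.
  by move=> u; have /andP[? ?] := phi01 (u, s'); apply/andP; split; lra.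
have hB : {ae mu, forall s, forall s', (\int[mu]_u ((1 - phi (u, s'))%:E * (q s u)%:E) <=
     \int[mu]_u ((1 - phi (u, s))%:E * (q s u)%:E))%E}.
  have aeB := ae_signalB alpha_gt0 beta_gt0 model brB.
  apply: (@filterS _ _ (ae_filter_ringOfSetsType mu) _ _ _ aeB) => s Hs s'.
  rewrite (winB s s') (winB s s) lee_fin ler_wpM2l//.
  by rewrite ltW//; have [] := integral_prior_pdf alpha_gt0 beta_gt0 s.
have imit := imitation_optimal alpha_gt0 beta_gt0 model mphi phi01 hA hB.
have path := voter_on_path alpha_gt0 beta_gt0 model my yinj yc nuk wopt.
(* By continuity g keeps its sign near s0. This is how a.e. information refutes a deviation at a
   single point, and why the conclusion holds at every signal. *)
pose g s := y s - 2 * beta / tau * s.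
apply: contrapT => ys0.
have g0 : g s0 != 0 by rewrite subr_eq0; apply/eqP.
have [e e0 He] : exists2 e, 0 < e & forall s, `|s - s0| < e -> 0 < g s * g s0.
  have gc : (fun s => g s * g s0) @ s0 --> g s0 * g s0.
    apply: cvgM; last exact: cvg_cst.
    apply: cvgB; first exact: yc.
    by apply: cvgM; [exact: cvg_cst|exact: cvg_id].
  have gg : 0 < g s0 * g s0 by rewrite -expr2 lt_neqAle sqr_ge0 andbT eq_sym sqrf_eq0.
  have nb : nbhs s0 (fun s => 0 < g s * g s0) by exact: cvgr_gt gc _ gg.
  have [e /= e0 He] := (nbhs_ballP _ _).1 nb.
  by exists e => // s ss0; apply: He; rewrite /ball/= distrC.
have good : {ae mu, forall s', {ae mu, forall s, (\int[mu]_u ((phi (s', u))%:E * (q s u)%:E) =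
       \int[mu]_u ((phi (s, u))%:E * (q s u)%:E))%E} /\
     {ae mu, forall u, let m := post_mean2 alpha beta s' u in
       ((y s' - m) ^+ 2 < (y u - m) ^+ 2 -> phi (s', u) = 1) /\
       ((y u - m) ^+ 2 < (y s' - m) ^+ 2 -> phi (s', u) = 0)}}.
  exact: (@filterI _ _ (ae_filter_ringOfSetsType mu) _ _ imit path).
(* The a.e. statements may fail at s0 itself, so one good signal is taken on each side of it;
   opponent signals between the two will give D a constant value. *)
have [s1 /andP[s1e s10] [im1 on1]] := ae_exists_in_itv (a := s0 - e) (b := s0) ltac:(by lra) good.
have [s2 /andP[s20 s2e] [im2 on2]] := ae_exists_in_itv (a := s0) (b := s0 + e) ltac:(by lra) good.
pose D u := phi (s1, u) - phi (s2, u).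
have mD : measurable_fun setT D by exact: measurable_funB.
have D1 u : `|D u| <= 1.
  have /andP[? ?] := phi01 (s1, u); have /andP[? ?] := phi01 (s2, u).
  by rewrite ler_norml; apply/andP; split; rewrite /D; lra.
have t0 := tau_gt0 alpha_gt0 beta_gt0.
have l0 : 0 < beta ^+ 2 / tau by rewrite divr_gt0// exprn_gt0.
(* The ratio of the two sides is beta / (alpha + beta), the correlation of the signals. *)
have ld : beta ^+ 2 / tau < 2 * (beta * (alpha + beta) / tau / 2).
  have -> : 2 * (beta * (alpha + beta) / tau / 2) = beta * (alpha + beta) / tau.
    by rewrite [LHS]mulrC divfK.
  by rewrite ltr_pM2r ?invr_gt0// expr2 ltr_pM2l// ltrDr.
have ker : {ae mu, forall s, (\int[mu]_u (D u * expR (- (beta * (alpha + beta) / tau / 2) *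
    (s ^+ 2 + u ^+ 2) + beta ^+ 2 / tau * (s * u)))%:E = 0)%E}.
  have im12 := @filterI _ _ (ae_filter_ringOfSetsType mu) _ _ im1 im2.
  apply: (@filterS _ _ (ae_filter_ringOfSetsType mu) _ _ _ im12) => s [i1 i2].
  have iq v : mu.-integrable setT (fun u => (phi (v, u))%:E * (q s u)%:E)%E.
    apply/integrableP; split.
      apply: emeasurable_funM; first by apply/measurable_EFinP; exact: mpR.
      by apply/measurable_EFinP; exact: measurable_signal_pdf.
    under eq_integral => u _.
      rewrite gee0_abs; last first.
        rewrite mule_ge0// lee_fin; first by case/andP: (phi01 (v, u)).
        by rewrite ltW// signal_pdf_gt0.
      over.
    by rewrite winA ltry.
  set C := normal_peak (prec_sd alpha) * normal_peak (prec_sd beta) ^+ 2 /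
    normal_peak (prec_sd tau).
  have C0 : C != 0.
    have := signal_pdf_gt0 alpha_gt0 beta_gt0 0 0; rewrite /signal_pdf -/C.
    by rewrite pmulr_lgt0 ?expR_gt0// => /lt0r_neq0.
  transitivity (\int[mu]_u ((C^-1)%:E * ((phi (s1, u))%:E * (q s u)%:E - (phi (s2, u))%:E * (q s u)%:E)))%E.
    have aux (D' ex f1 f2 qq : R) : D' = f1 - f2 -> qq = C * ex ->
        (D' * ex)%:E = ((C^-1)%:E * (f1%:E * qq%:E - f2%:E * qq%:E))%E.
      move=> -> ->.
      by transitivity ((C^-1 * (f1 * (C * ex) - f2 * (C * ex)))%:E); [congr EFin; field|].
    by apply: eq_integral => u _; exact: aux.
  rewrite integralZl//; last exact: integrableB.
  rewrite integralB// i1 i2 subee ?mule0//.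
  by apply: integrable_fin_num => //; exact: iq.
pose a := (s1 + s2) / 2; pose r := (s2 - s1) / 2.
have r0 : 0 < r by rewrite divr_gt0// subr_gt0; lra.
have compl K := kernel_complete a K l0 ld mD D1 ker.
(* Twice the gap between the midpoint of the platforms and the posterior mean is g s + g u, so the
   signs of g and of the platform difference decide the election. *)
have sqE s u : (y s - post_mean2 alpha beta s u) ^+ 2 - (y u - post_mean2 alpha beta s u) ^+ 2 =
    (y s - y u) * (g s + g u).
  by rewrite /post_mean2 /g; ring.
have on12 : {ae mu, forall u, s1 < u < s2 ->
   (((y s1 - y u) * (g s1 + g u) < 0 -> phi (s1, u) = 1) /\
    (0 < (y s1 - y u) * (g s1 + g u) -> phi (s1, u) = 0)) /\
   (((y s2 - y u) * (g s2 + g u) < 0 -> phi (s2, u) = 1) /\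
    (0 < (y s2 - y u) * (g s2 + g u) -> phi (s2, u) = 0))}.
  have on := @filterI _ _ (ae_filter_ringOfSetsType mu) _ _ on1 on2.
  apply: (@filterS _ _ (ae_filter_ringOfSetsType mu) _ _ _ on) => u [[p11 p10] [p21 p20]] _.
  rewrite -!sqE !subr_lt0 !subr_gt0; do 2 split => //.
have near_s0 u : s1 <= u <= s2 -> 0 < g u * g s0.
  by move=> /andP[? ?]; apply: He; rewrite ltr_norml; apply/andP; split; lra.
have gsum s u : s1 <= s <= s2 -> s1 <= u <= s2 -> 0 < (g s + g u) * g s0.
  by move=> hs hu; rewrite mulrDl addr_gt0// near_s0.
have s12 : s1 < s2 by lra.
have h1 : s1 <= s1 <= s2 by rewrite lexx ltW.
have h2 : s1 <= s2 <= s2 by rewrite lexx ltW.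
have ball_itv u : `|u - a| < r -> s1 < u < s2.
  by rewrite ltr_norml /a /r => /andP[? ?]; apply/andP; split; lra.
(* If g is positive near s0 the lower platform wins, otherwise the higher one. For s1 < u < s2
   monotonicity of y makes exactly one of y s1, y s2 win against y u, and b is 1 when it is y s1. *)
pose b : R := if (0 < g s0) == (y s1 < y s2) then 1 else -1.
have b1 : `|b| = 1 by rewrite /b; case: ifP => _; rewrite ?normrN normr1.
apply: (no_constant_sign r0 mD D1 b1 _ compl).
apply: (@filterS _ _ (ae_filter_ringOfSetsType mu) _ _ _ on12) => u + /ball_itv su.
move=> /(_ su); have /andP[s1u us2] := su.
have hu : s1 <= u <= s2 by rewrite !ltW.
have := gsum _ _ h1 hu; have := gsum _ _ h2 hu.
have ymon : (y s1 < y u /\ y u < y s2) \/ (y u < y s1 /\ y s2 < y u).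
  have [ym|ym] := continuous_inj_mono yinj yc; [left|right].
    by rewrite !(leW_mono ym).
  by rewrite !(leW_nmono ym).
move=> G2 G1 [[p11 p10] [p21 p20]].
case: (ltgtP 0 (g s0)) g0 => // gs0 _.
  have {}G1 : 0 < g s1 + g u by move: G1; rewrite pmulr_lgt0.
  have {}G2 : 0 < g s2 + g u by move: G2; rewrite pmulr_lgt0.
  case: ymon => -[Y1 Y2].
    rewrite /b gs0 (lt_trans Y1 Y2) /D p11 ?p20 ?subr0//.
      by rewrite pmulr_lgt0// subr_gt0.
    by rewrite pmulr_llt0// subr_lt0.
  rewrite /b gs0 [y s1 < y s2]ltNge (ltW (lt_trans Y2 Y1)) /= /D p10 ?p21 ?sub0r//.
    by rewrite pmulr_llt0// subr_lt0.
  by rewrite pmulr_lgt0// subr_gt0.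
have {}G1 : g s1 + g u < 0 by move: G1; rewrite nmulr_lgt0.
have {}G2 : g s2 + g u < 0 by move: G2; rewrite nmulr_lgt0.
case: ymon => -[Y1 Y2].
  rewrite /b [0 < g s0]ltNge (ltW gs0) (lt_trans Y1 Y2) /= /D p10 ?p21 ?sub0r//.
    by rewrite nmulr_llt0// subr_gt0.
  by rewrite nmulr_lgt0// subr_lt0.
rewrite /b [0 < g s0]ltNge (ltW gs0) [y s1 < y s2]ltNge (ltW (lt_trans Y2 Y1)) /= /D p11 ?p20 ?subr0//.
  by rewrite nmulr_lgt0// subr_lt0.
by rewrite nmulr_llt0// subr_gt0.
Qed.

End Uniqueness.

(** * Existence and welfare *)

Section Equilibrium.
Context (R : realType) (alpha beta : R) (alpha_gt0 : 0 < alpha) (beta_gt0 : 0 < beta).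
Local Notation mu := (@lebesgue_measure R).
Local Notation tau := (alpha + 2 * beta).
Context d (Omega : measurableType d) (P : probability Omega R).
Variables (theta sA sB : {RV P >-> R}).
Hypothesis model : normal_model alpha beta theta sA sB.

Let c := 2 * beta / tau.
Let y (s : R) := c * s.
Let loss := (alpha + 4 * beta) / tau ^+ 2.
Let t0 : 0 < tau := tau_gt0 alpha_gt0 beta_gt0.
Let c0 : 0 < c. Proof. by rewrite divr_gt0// mulr_gt0. Qed.
Let my : measurable_fun setT y. Proof. exact: measurable_funM. Qed.
Let mz : measurable_fun setT (fun x : R => x / c). Proof. exact: measurable_funM. Qed.
Let yK : cancel y (fun x => x / c).
Proof. by move=> s; rewrite /y mulrC mulKf// gt_eqF. Qed.

Let sq_loss (w : R * R -> R) (p : R * R * R) : R :=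
  w (y p.1.1, y p.1.2) * (y p.1.1 - p.2) ^+ 2 +
  (1 - w (y p.1.1, y p.1.2)) * (y p.1.2 - p.2) ^+ 2.

Let msq_loss w : voter_strategy w -> measurable_fun setT (EFin \o sq_loss w).
Proof.
move=> [mw _]; apply/measurable_EFinP.
have m1 : measurable_fun setT (fun p : R * R * R => p.1.1) by apply: measurableT_comp.
have m2 : measurable_fun setT (fun p : R * R * R => p.1.2) by apply: measurableT_comp.
have m3 : measurable_fun setT (fun p : R * R * R => p.2) by exact: measurable_snd.
have mw' : measurable_fun setT (fun p : R * R * R => w (y p.1.1, y p.1.2)).
  by apply: (measurableT_comp mw); apply: measurable_fun_pair; exact: measurableT_comp.
have msq (f : R * R * R -> R) : measurable_fun setT f ->
    measurable_fun setT (fun p => (y (f p) - p.2) ^+ 2).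
  by move=> mf; apply: measurable_funX; apply: measurable_funB => //; exact: measurableT_comp.
apply: measurable_funD; apply: measurable_funM => //.
- exact: (msq _ m1).
- exact: measurable_funB.
- exact: (msq _ m2).
Qed.

Let sq_loss_ge0 w p : voter_strategy w -> 0 <= sq_loss w p.
Proof.
move=> [_ w01]; have /andP[w0 w1] := w01 (y p.1.1, y p.1.2).
by rewrite addr_ge0// mulr_ge0 ?sqr_ge0// subr_ge0.
Qed.

(* The posterior mean is the midpoint of the two platforms, so the posterior
   expected loss is the same whoever is elected. *)
Let integral_sq_loss_indep w w' : voter_strategy w -> voter_strategy w' ->
  (\int[P]_o (sq_loss w (sA o, sB o, theta o))%:E =
   \int[P]_o (sq_loss w' (sA o, sB o, theta o))%:E)%E.
Proof.
have post v s u : voter_strategy v ->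
    (\int[normal_prob (post_mean2 alpha beta s u) (prec_sd tau)]_t
       (sq_loss v (s, u, t))%:E =
     ((y s - post_mean2 alpha beta s u) ^+ 2 + prec_sd tau ^+ 2)%:E)%E.
  move=> [_ v01]; have /andP[v0 v1] := v01 (y s, y u).
  have ms (x : R) : measurable_fun setT (fun t : R => ((x - t) ^+ 2)%:E).
    by apply/measurable_EFinP/measurable_funX/measurable_funB.
  have sp0 := prec_sd_neq0 t0.
  under eq_integral do rewrite /sq_loss/= EFinD !EFinM.
  rewrite ge0_integralD//; first last.
  - by apply: emeasurable_funM => //; exact: ms.
  - by move=> t _; rewrite -EFinM lee_fin mulr_ge0 ?sqr_ge0// subr_ge0.
  - by apply: emeasurable_funM => //; exact: ms.
  - by move=> t _; rewrite -EFinM lee_fin mulr_ge0 ?sqr_ge0.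
  rewrite !ge0_integralZl//;
    try by [exact: ms|rewrite lee_fin|rewrite lee_fin subr_ge0|move=> t _; rewrite lee_fin sqr_ge0].
  rewrite !integral_normal_prob_sqrB// -!EFinM -EFinD; congr EFin.
  have -> : (y u - post_mean2 alpha beta s u) ^+ 2 = (y s - post_mean2 alpha beta s u) ^+ 2.
    rewrite -[LHS]sqrrN; congr (_ ^+ 2); rewrite /post_mean2 /y /c; field.
    by rewrite gt_eqF.
  ring.
move=> vw vw'.
rewrite (integral_law_post alpha_gt0 beta_gt0 model (msq_loss vw)); last first.
  by move=> p; rewrite lee_fin sq_loss_ge0.
rewrite (integral_law_post alpha_gt0 beta_gt0 model (msq_loss vw')); last first.
  by move=> p; rewrite lee_fin sq_loss_ge0.
by apply: eq_integral => s _; apply: eq_integral => u _; rewrite /= !post.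
Qed.

Let const_strategy (a : R) : 0 <= a <= 1 -> voter_strategy (fun _ : R * R => a).
Proof. by []. Qed.

Let s1 : voter_strategy (fun _ : R * R => 1 : R).
Proof. by apply: const_strategy; rewrite ler01 lexx. Qed.
Let s2 : voter_strategy (fun _ : R * R => 0 : R).
Proof. by apply: const_strategy; rewrite ler01 lexx. Qed.

Let integral_sq_loss1 :
  (\int[P]_o (sq_loss (fun=> 1%R) (sA o, sB o, theta o))%:E = loss%:E)%E.
Proof.
rewrite (integral_law_prior alpha_gt0 beta_gt0 model (msq_loss s1)); last first.
  by move=> p; rewrite lee_fin sq_loss_ge0.
have sa0 := prec_sd_neq0 alpha_gt0; have sb0 := prec_sd_neq0 beta_gt0.
have mb t : measurable_fun setT (normal_pdf t (prec_sd beta)) by exact: measurable_normal_pdf.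
(* Writing (c s - t) ^+ 2 as c ^+ 2 (t / c - s) ^+ 2 gives the shape whose normal expectation is
   known. The result (1 - c) ^+ 2 t ^+ 2 + c ^+ 2 / beta splits the error into shrinkage bias and
   signal noise. *)
have inner t : (\int[mu]_s \int[mu]_u ((EFin \o sq_loss (fun=> 1%R)) (s, u, t) *
      (joint_pdf alpha beta t s u)%:E) =
    (((1 - c) ^+ 2)%:E * ((0 - t) ^+ 2)%:E + (c ^+ 2 / beta)%:E) *
      (normal_pdf 0 (prec_sd alpha) t)%:E)%E.
  transitivity (\int[mu]_s ((normal_pdf 0 (prec_sd alpha) t * c ^+ 2)%:E *
      (((t / c - s) ^+ 2)%:E * (normal_pdf t (prec_sd beta) s)%:E)))%E.
    apply: eq_integral => s _.
    transitivity (\int[mu]_u (((normal_pdf 0 (prec_sd alpha) t * c ^+ 2) *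
      ((t / c - s) ^+ 2 * normal_pdf t (prec_sd beta) s))%:E *
      (normal_pdf t (prec_sd beta) u)%:E))%E.
      apply: eq_integral => u _; rewrite /= /sq_loss/= -!EFinM /joint_pdf; congr EFin.
      rewrite subrr mul0r addr0 mul1r.
      have -> : (y s - t) ^+ 2 = c ^+ 2 * (t / c - s) ^+ 2.
        by rewrite -exprMn mulrBr [c * (t / c)]mulrC divfK ?gt_eqF// -sqrrN opprB.
      ring.
    rewrite ge0_integralZl//.
    - by rewrite integral_normal_pdf mule1 -!EFinM.
    - by apply/measurable_EFinP; exact: mb.
    - by move=> u _; rewrite lee_fin normal_pdf_ge0.
    - rewrite lee_fin; apply: mulr_ge0; apply: mulr_ge0;
        by rewrite ?sqr_ge0 ?normal_pdf_ge0.
  have ms : measurable_fun setT (fun s : R => ((t / c - s) ^+ 2)%:E).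
    by apply/measurable_EFinP/measurable_funX/measurable_funB.
  rewrite ge0_integralZl//.
  - rewrite -ge0_integral_normal_prob//; last by move=> s; rewrite lee_fin sqr_ge0.
    rewrite integral_normal_prob_sqrB// sqr_prec_sd//.
    transitivity ((normal_pdf 0 (prec_sd alpha) t * c ^+ 2 * ((t / c - t) ^+ 2 + beta^-1))%:E);
      first by [].
    transitivity ((((1 - c) ^+ 2 * (0 - t) ^+ 2 + c ^+ 2 / beta) *
      normal_pdf 0 (prec_sd alpha) t)%:E); last by [].
    congr EFin.
    have -> : t / c - t = (1 - c) * t / c by rewrite mulrBl mul1r mulrBl mulrAC divff ?gt_eqF// mul1r.
    by field; rewrite !gt_eqF.
  - by apply: emeasurable_funM => //; apply/measurable_EFinP; exact: mb.
  - by move=> s _; rewrite mule_ge0// lee_fin ?sqr_ge0// normal_pdf_ge0.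
  - by rewrite lee_fin mulr_ge0 ?sqr_ge0 ?normal_pdf_ge0.
under eq_integral do rewrite inner.
have ms : measurable_fun setT (fun s : R => ((0 - s) ^+ 2)%:E).
  by apply/measurable_EFinP/measurable_funX/measurable_funB.
have cb0 : 0 <= c ^+ 2 / beta by rewrite divr_ge0 ?sqr_ge0// ltW.
rewrite -ge0_integral_normal_prob//.
- rewrite ge0_integralD//.
  + rewrite ge0_integralZl//.
    * rewrite integral_normal_prob_sqrB// integral_normal_prob_cst -EFinM -EFinD; congr EFin.
      rewrite subr0 expr0n/= add0r sqr_prec_sd// /loss /c.
      by field; rewrite !gt_eqF.
    * by move=> t _; rewrite lee_fin sqr_ge0.
    * by rewrite lee_fin sqr_ge0.
  + by move=> t _; rewrite -EFinM lee_fin mulr_ge0 ?sqr_ge0.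
  + exact: emeasurable_funM.
- apply: emeasurable_funD => //; exact: emeasurable_funM.
- by move=> t; rewrite -EFinM -EFinD lee_fin addr_ge0// mulr_ge0 ?sqr_ge0.
Qed.

Let integral_sq_loss w : voter_strategy w ->
  (\int[P]_o (sq_loss w (sA o, sB o, theta o))%:E = loss%:E)%E.
Proof. by move=> vw; rewrite (integral_sq_loss_indep vw s1) integral_sq_loss1. Qed.

Lemma voter_welfare_linear w : voter_strategy w ->
  voter_welfare theta sA sB y y w = (- loss)%:E.
Proof.
move=> vw; rewrite /voter_welfare unlock EFinN -(integral_sq_loss vw).
rewrite -integral_ge0N; last by move=> o _; rewrite lee_fin sq_loss_ge0.
apply: eq_integral => o _; rewrite -EFinN /sq_loss /platforms/=; congr EFin.
by rewrite opprD !mulrN.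
Qed.

(** If A is always elected, the voter's loss is A's own squared error, so its finiteness comes from
    the welfare computation; for B the rule electing B is used. *)
Lemma strategy_linearA : strategy theta sA y.
Proof.
split => //; rewrite unlock; apply: le_lt_trans (ltry loss).
rewrite -(integral_sq_loss s1) le_eqVlt; apply/orP; left; apply/eqP.
by apply: eq_integral => o _; rewrite /sq_loss/= subrr mul0r addr0 mul1r.
Qed.

Lemma strategy_linearB : strategy theta sB y.
Proof.
split => //; rewrite unlock; apply: le_lt_trans (ltry loss).
rewrite -(integral_sq_loss s2) le_eqVlt; apply/orP; left; apply/eqP.
by apply: eq_integral => o _; rewrite /sq_loss/= mul0r add0r subr0 mul1r.
Qed.

Lemma equilibrium_linear :
  symmetric_equilibrium alpha beta theta sA sB y y (fun=> 2^-1).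
Proof.
have half01 : 0 <= (2^-1 : R) <= 1 by apply/andP; split; lra.
have vhalf := const_strategy half01.
split; first split.
- by split; [exact: strategy_linearA|exact: strategy_linearB|exact: vhalf].
- split.
  + by apply: aeW => s x.
  + by apply: aeW => s x.
  (* The linear strategy is onto, so every platform pair decodes to signals and the same formula
     serves as belief at every pair. Its mean is the midpoint of the two platforms, so the voter is
     indifferent everywhere. *)
  + exists (fun p => normal_prob (post_mean2 alpha beta (p.1 / c) (p.2 / c)) (prec_sd tau)).
      exists (post_kernel alpha_gt0 beta_gt0 mz).
        exact: post_kernel_conditional_law.
      exists set0; split => //; first by rewrite /pushforward preimage_set0 measure0.
      by move=> p /=; apply.
    move=> xA xB.
    pose m := post_mean2 alpha beta (xA / c) (xB / c).
    have E x : voter_eu (normal_prob m (prec_sd tau)) x =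
        (- ((x - m) ^+ 2 + prec_sd tau ^+ 2))%:E by exact: voter_eu_normal.
    have sqE : (xB - m) ^+ 2 = (xA - m) ^+ 2.
      rewrite -[LHS]sqrrN; congr (_ ^+ 2); rewrite /m /post_mean2 /c; field.
      by rewrite !gt_eqF.
    by split; rewrite /= !E sqE ltxx.
- split => //.
  + by rewrite /winprobA unlock integral_cst//= [X in (_ * X)%E]probability_setT mule1 lte_fin invr_gt0.
  + rewrite /winprobB unlock integral_cst//= [X in (_ * X)%E]probability_setT mule1 lte_fin; lra.
Qed.

End Equilibrium.

Theorem proposition2 (R : realType) (alpha beta : R)
    (alpha_gt0 : 0 < alpha) (beta_gt0 : 0 < beta)
    (d : measure_display) (Omega : measurableType d) (P : probability Omega R)
    (theta sA sB : {RV P >-> R})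
    (model : normal_model alpha beta theta sA sB) :
  let ystar := fun s : R => 2 * beta / (alpha + 2 * beta) * s in
  let half := fun _ : R * R => 2^-1 : R in
  let welfare := - ((alpha + 4 * beta) / (alpha + 2 * beta) ^+ 2) in
  (forall s : R, posterior_mean alpha beta [:: s; s] = ystar s) /\
  symmetric_equilibrium alpha beta theta sA sB ystar ystar half /\
  anti_pandering alpha beta ystar /\
  injective ystar /\
  voter_welfare theta sA sB ystar ystar half = welfare%:E /\
  (forall (yA yB : R -> R) (wA : R * R -> R),
     symmetric_equilibrium alpha beta theta sA sB yA yB wA ->
     injective yA -> continuous yA -> injective yB -> continuous yB ->
     (forall s : R, yA s = ystar s) /\
     (forall s : R, yB s = ystar s) /\
     voter_welfare theta sA sB yA yB wA = welfare%:E).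
Proof.
move=> ystar half welfare.
have t0 := tau_gt0 alpha_gt0 beta_gt0.
have ab0 := addr_gt0 alpha_gt0 beta_gt0.
have eqm := equilibrium_linear alpha_gt0 beta_gt0 model.
(* Anti-pandering is a comparison of slopes; after cross-multiplication it says 0 < alpha * beta. *)
have lt_coef : beta / (alpha + beta) < 2 * beta / (alpha + 2 * beta).
  rewrite ltr_pdivrMr// mulrAC ltr_pdivlMr//; nra.
split.
  move=> s; rewrite posterior_mean2// /post_mean2 /ystar.
  by field; rewrite gt_eqF.
split; first exact: eqm.
split.
  move=> s; rewrite posterior_mean1// mulrAC /ystar.
  by split => s0; [rewrite ltr_pM2r|rewrite ltr_nM2r].
split.
  by apply: mulfI; rewrite gt_eqF// divr_gt0// mulr_gt0.
split.
  by apply: voter_welfare_linear => //; have [[[_ _ ? _]]] := eqm.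
move=> yA yB wA [] eqAB [yAB _ _] yAinj yAc _ _.
rewrite -yAB in eqAB *.
have yE : forall s, yA s = ystar s by exact: equilibrium_platform eqAB.
split=> //; split=> //.
(* Nothing has been determined about [wA]; the welfare formula holds for every voter strategy. *)
have -> : yA = ystar by apply/funext.
by apply: voter_welfare_linear => //; have [[]] := eqAB.
Qed.
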